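(* Let $\mathbf{A}$ be an idempotent algebra and $k>1$. The following are equivalent: (1) $\mathbf{A}$ (or equivalently $\mathbf{A}^2$) has local near unanimity term operations of arity $k+2$; (2) every $(k,k+1)$-instance over $\mathbf{A}^2$ is sensitive; (3) every $(k,k+1)$-instance over $\mathbf{A}^2$ with exactly $k+2$ variables is sensitive.
   Context: An algebra is idempotent if every basic operation $f$ satisfies $f(a,\dots,a)=a$. An algebra $\mathbf{B}$ (possibly infinite) has local near unanimity term operations of arity $m$ if for every finite $S\subseteq B$ there is an $m$-ary term operation $n_S$ with $n_S(b,a,\dots,a)=n_S(a,b,a,\dots,a)=\dots=n_S(a,\dots,a,b)=a$ for all $a,b\in S$. A CSP instance is a pair $(V,\mathcal{C})$ with $V$ a finite set of variables and $\mathcal{C}$ a set of constraints $((x_1,\dots,x_n),R)$. An instance over an algebra $\mathbf{B}$ has all variables ranging over $B$ and every constraint relation a subuniverse of a finite power of $\mathbf{B}$. A solution is a map $f:V\to B$ with $(f(x_1),\dots,f(x_n))\in R$ for all constraints. For $W\subseteq V$, $\mathcal{I}_{|W}$ has variable set $W$ and the constraints all of whose variables lie in $W$. An instance is $k$-uniform if all constraints are $k$-ary and every $k$-element set of variables is constrained by a single constraint (several constraints on the same variable set are tolerated if they impose the same restriction up to permuting coordinates). A $(k,k+1)$-instance is a $k$-uniform instance such that for every $(k+1)$-element $W\subseteq V$, every tuple in every constraint of $\mathcal{I}_{|W}$ extends to a solution of $\mathcal{I}_{|W}$. An instance is sensitive if every tuple in every constraint relation extends to a solution. *)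

(* Defs.v *)
From mathcomp Require Import all_boot.
From mathcomp Require Import classical_sets cardinality.

Set Implicit Arguments.
Unset Strict Implicit.
Unset Printing Implicit Defensive.

Record algebra := Algebra {
  symbol : Type;
  op_arity : symbol -> nat;
  carrier :> Type;
  op : forall f : symbol, ('I_(op_arity f) -> carrier) -> carrier
}.

Arguments op {a} f _.

Definition idempotent_algebra (B : algebra) : Prop :=
  forall (f : symbol B) (a : B), op f (fun _ => a) = a.

(* Functions are used for tuples, so that the n-th power of [B] has carrier
   ['I_n -> B]. *)
Definition power (B : algebra) (n : nat) : algebra :=
  @Algebra (symbol B) (@op_arity B) ('I_n -> B)
    (fun f x i => op f (fun j => x j i)).

Definition subuniverse (B : algebra) (R : set B) : Prop :=
  forall (f : symbol B) (x : 'I_(op_arity f) -> B),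
    (forall j, R (x j)) -> R (op f x).

Inductive term (B : algebra) (X : Type) : Type :=
| Var of X
| App (f : symbol B) of ('I_(op_arity f) -> term B X).

Fixpoint eval (B : algebra) (X : Type) (v : X -> B) (t : term B X) : B :=
  match t with
  | Var x => v x
  | App f ts => op f (fun j => eval v (ts j))
  end.

Definition term_operation (B : algebra) (m : nat) (g : ('I_m -> B) -> B) :
    Prop :=
  exists t : term B 'I_m, forall x, g x = eval x t.

Definition local_near_unanimity (m : nat) (B : algebra) : Prop :=
  forall S : set B, finite_set S ->
  exists2 g : ('I_m -> B) -> B, term_operation g &
    forall (a b : B) (i : 'I_m), S a -> S b ->
      g (fun j => if j == i then b else a) = a.

Record constraint (V B : Type) := Constraint {
  con_arity : nat;
  scope : 'I_con_arity -> V;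
  rel_of : set ('I_con_arity -> B)
}.

Record instance (B : Type) := Instance {
  var : finType;
  constraints : set (constraint var B)
}.

Arguments constraints {B} _ _.
Arguments scope {V B} _ _.
Arguments rel_of {V B} _ _.

Definition instance_over (B : algebra) (I : instance B) : Prop :=
  forall c, constraints I c -> @subuniverse (power B (con_arity c)) (rel_of c).

Definition solution (B : Type) (I : instance B) (f : var I -> B) : Prop :=
  forall c, constraints I c -> rel_of c (fun i => f (scope c i)).

Definition sensitive (B : Type) (I : instance B) : Prop :=
  forall c, constraints I c -> forall t, rel_of c t ->
  exists2 f : var I -> B, solution f & forall i, f (scope c i) = t i.

Definition rename_scope (V V' B : Type) (h : V -> V') (c : constraint V B) :
    constraint V' B :=
  @Constraint V' B (con_arity c) (fun i => h (scope c i)) (rel_of c).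

(* A constraint over the variables of [I] has all its variables in [W] exactly
   when it is the image under [val] of a constraint over the subtype. *)
Definition restriction (B : Type) (I : instance B) (W : {set var I}) :
    instance B :=
  @Instance B {x : var I | x \in W}
    (fun c => constraints I (rename_scope val c)).

Definition same_restriction (V B : Type) (c c' : constraint V B) : Prop :=
  exists s : 'I_(con_arity c') -> 'I_(con_arity c),
    [/\ bijective s, forall i, scope c' i = scope c (s i)
      & forall t, rel_of c t <-> rel_of c' (fun i => t (s i))].

(* A [k]-ary constraint of a [k]-uniform instance is one on a [k]-element set of
   variables, so its scope has no repetitions. If repetitions were allowed, then
   the one-variable instance whose only constraint puts the full binary relation
   on [(x, x)] would be a (2,3)-instance, and it is not sensitive when the domain has at
   least two elements. *)
Definition uniform (k : nat) (B : Type) (I : instance B) : Prop :=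
  [/\ forall c, constraints I c -> con_arity c = k /\ injective (scope c),
      forall W : {set var I}, #|W| = k ->
        exists2 c, constraints I c & codom (scope c) =i W
    & forall c c', constraints I c -> constraints I c' ->
        codom (scope c) =i codom (scope c') -> same_restriction c c'].

Definition kk1_instance (k : nat) (B : Type) (I : instance B) : Prop :=
  uniform k I /\
  forall W : {set var I}, #|W| = k.+1 -> sensitive (restriction W).

(* Main.v *)
(* From near unanimity to sensitivity, one extends a tuple [t] on a [k]-set [K]
   to ever larger sets [W]. By Helly's property of absorbing sets
   (Baker-Pixley), a system of constraints in which [t] is prescribed in several
   places is solvable as soon as it is solvable for any [k+1] of the prescribed
   values. These carry only [k] labels, so some label occurs at most once, say in
   a constraint with trace [Z] on [W \ K]. If [|Z| <= 1], then the remaining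
   [k-1] labels and the point of [Z] form a [k]-tuple that extends by induction.
   Otherwise the system is unrolled at some [x] of [Z] into a cycle of four
   copies, which is solvable by Baker-Pixley and induction on the traces, and a
   loop lemma (a relation that absorbs the equality and has a closed walk has a
   loop) rolls it up again.

   Conversely, let [G] be generated by the [k+2] tuples that differ from [a] in
   one coordinate. The [k]-ary constraints on pairs of coordinates stating
   membership in projections of [G], weakened to the proper projections on one
   [k]-set, form a [(k,k+1)]-instance in which [a] is permitted on that [k]-set,
   and a solution through it puts [a] in [G]. *)
Require Import Defs.
From mathcomp Require Import boolp classical_sets cardinality.
From mathcomp Require Import all_boot perm zify.

Set Implicit Arguments.
Unset Strict Implicit.
Unset Printing Implicit Defensive.

(** * Loops in relations with pins *)

Section NearUnanimity.

Variables (B : Type) (m : nat) (Clo : (('I_m -> B) -> B) -> Prop).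
Hypothesis m_gt1 : 1 < m.
Hypothesis Clo_idem : forall g, Clo g -> forall a, g (fun=> a) = a.
Hypothesis Clo_nu : forall (J : finType) (F : 'I_m -> J -> B),
  exists2 g, Clo g &
    forall j i0 c, (forall i, i != i0 -> F i j = c) -> g (F^~ j) = c.

Definition op_closed (J : Type) (P : (J -> B) -> Prop) : Prop :=
  forall g, Clo g -> forall F : 'I_m -> J -> B,
    (forall i, P (F i)) -> P (fun j => g (F^~ j)).

(** Induction on [#|M|]: if [M] has at least [m] elements, the induction hypothesis yields for each
    of [m] of them a member of [P] that is right on [M] except perhaps there. Each column over [M]
    then has at most one wrong entry, which near unanimity outvotes. *)
Lemma baker_pixley (J : finType) (P : (J -> B) -> Prop) (c : J -> B)
    (M0 : {set J}) : op_closed P ->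
  (forall M : {set J}, M \subset M0 -> #|M| < m ->
     exists2 F, P F & {in M, F =1 c}) ->
  exists2 F, P F & {in M0, F =1 c}.
Proof.
move=> Pcl small.
suff: forall n (M : {set J}), #|M| <= n -> M \subset M0 ->
        exists2 F, P F & {in M, F =1 c} by apply; [exact: leqnn|exact: subxx].
elim=> [|n IH] M Mn sM; first by apply: small => //; lia.
case: (ltnP #|M| m) => [|mM]; first exact: small.
pose e (i : 'I_m) : J := enum_val (widen_ord mM i).
have e_inj : injective e by move=> i j /enum_val_inj [] /ord_inj.
have eM i : e i \in M by exact: enum_valP.
have /choice[F HF] i : exists F, P F /\ {in M :\ e i, F =1 c}.
  have sMi : M :\ e i \subset M0 := subset_trans (subsetDl _ _) sM.
  have Mi : #|M :\ e i| <= n by have := cardsD1 (e i) M; rewrite eM; lia.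
  by have [F PF FM] := IH _ Mi sMi; exists F.
have [g Cg gF] := Clo_nu F.
exists (fun j => g (F^~ j)); first by apply: Pcl => // i; case: (HF i).
move=> j jM.
pose i0 := odflt (Ordinal (ltnW m_gt1)) [pick i | e i == j].
apply: (gF _ i0) => i ii0; apply: (HF i).2; rewrite !inE jM andbT.
apply: contraNneq ii0 => ej; rewrite /i0; case: pickP => [i1 /eqP|/(_ i)].
  by rewrite ej => /e_inj ->.
by rewrite ej eqxx.
Qed.

(* A binary relation [W] is presented as [W x y := Q x y c] for a closed [Q],
   where [c] prescribes the values of finitely many further entries (pins).
   Since near unanimity forgives one violation of each pin, [W] absorbs the
   pairs [(x, x)] that satisfy [Q] for some choice of the pins. *)
Definition pin_closed (M : finType) (Q : B -> B -> (M -> B) -> Prop) : Prop :=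
  forall g, Clo g -> forall (x y : 'I_m -> B) (p : 'I_m -> M -> B),
    (forall i, Q (x i) (y i) (p i)) -> Q (g x) (g y) (fun u => g (p^~ u)).

Definition pin_reflexive (M : finType) (Q : B -> B -> (M -> B) -> Prop)
    (c : M -> B) : Prop :=
  forall x y, Q x y c -> (exists p, Q x x p) /\ (exists p, Q y y p).

Definition clique (s : nat) (W : B -> B -> Prop) (e : 'I_s -> B) : Prop :=
  forall i j, i != j -> W (e i) (e j).

(** The loops at [y] indexed by [T] have pairwise disjoint sets of wrong pins, so [m] of them
    combine to a loop with all pins right. *)
Definition tolerates (M T : finType) (Q : B -> B -> (M -> B) -> Prop)
    (c : M -> B) (y : B) : Prop :=
  exists2 p : T -> M -> B, forall a, Q y y (p a) &
    forall u a a', p a u <> c u -> p a' u <> c u -> a = a'.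

Lemma tolerates_loop (M T : finType) Q (c : M -> B) y :
  pin_closed Q -> m <= #|T| -> tolerates T Q c y -> Q y y c.
Proof.
move=> Qcl mT [p pQ p1].
pose e (i : 'I_m) : T := enum_val (widen_ord mT i).
have e_inj : injective e by move=> i j /enum_val_inj [] /ord_inj.
have [g Cg gp] := Clo_nu (fun i => p (e i)).
have := Qcl _ Cg (fun=> y) (fun=> y) _ (fun i => pQ (e i)).
rewrite (Clo_idem Cg); congr (Q _ _ _); apply/funext => u.
pose i0 := odflt (Ordinal (ltnW m_gt1)) [pick i | `[< p (e i) u <> c u >]].
apply: (gp _ i0) => i ii0; apply: contrapT => pi.
move: ii0; rewrite /i0; case: pickP => [i1 /asboolP pi1|/(_ i)/asboolP //].
by rewrite -(e_inj _ _ (p1 _ _ _ pi pi1)) eqxx.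
Qed.

(** The loop is at [g e]: near unanimity first joins each [e i] to [g e], by combining the edges
    from [e i] with a loop at [e i] whose pins may be wrong; applied to these new edges, it then
    moves their first end to [g e]. *)
Lemma big_clique_loop (M : finType) Q (c : M -> B) (e : 'I_m -> B) :
  pin_closed Q -> pin_reflexive Q c -> clique (fun x y => Q x y c) e ->
  exists u, Q u u c.
Proof.
move=> Qcl Qrefl cle.
have /choice[p pQ] i : exists p, Q (e i) (e i) p.
  have [j ij] : exists j : 'I_m, i != j.
    have m_gt0 := ltnW m_gt1.
    case: (eqVneq i (Ordinal m_gt0)) => [->|]; last by eexists; eassumption.
    by exists (Ordinal m_gt1).
  exact: (Qrefl _ _ (cle _ _ ij)).1.
have [g Cg gp] := Clo_nu
  (fun j (iu : 'I_m * M) => if j == iu.1 then p j iu.2 else c iu.2).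
have eu i : Q (e i) (g e) c.
  have := Qcl _ Cg (fun=> e i) e (fun j u => if j == i then p j u else c u).
  rewrite (Clo_idem Cg) => /(_ _)-QQ.
  have {QQ} : Q (e i) (g e) (fun u => g (fun j => if j == i then p j u else c u)).
    apply: QQ => j; case: (eqVneq j i) => [->|ji]; first exact: pQ.
    by apply: cle; rewrite eq_sym.
  congr (Q _ _ _); apply/funext => u.
  by apply: (gp (i, u) i) => j /negbTE /= ->.
exists (g e).
have := Qcl _ Cg e (fun=> g e) (fun=> c) eu; rewrite (Clo_idem Cg).
by congr (Q _ _ _); apply/funext => u; exact: (Clo_idem Cg).
Qed.

(* [K_{s+1}] with its vertex [0] split into [x], joined to [1], and [y], joined
   to the other vertices: a loop of this relation is an [s+1]-clique, and the
   edges {0,1} and {0,2} can be contracted independently, which doubles the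
   tolerance at the vertices of an [s]-clique. *)
Definition split_vertex (s : nat) (x y : B) (z : 'I_s.+1 -> B)
    (a b : 'I_s.+1) : B :=
  if a == 0 :> nat then (if b == 1 :> nat then x else y) else z a.

Definition split_clique (s : nat) (M : finType)
    (Q : B -> B -> (M -> B) -> Prop) (x y : B)
    (P : 'I_s.+1 * 'I_s.+1 * M -> B) : Prop :=
  exists z, forall a b, a != b ->
    Q (split_vertex x y z a b) (split_vertex x y z b a) (fun u => P (a, b, u)).

Lemma split_clique_closed s (M : finType) (Q : B -> B -> (M -> B) -> Prop) :
  pin_closed Q -> pin_closed (@split_clique s M Q).
Proof.
move=> Qcl g Cg x y p /choice[z zQ].
exists (fun a => g (z^~ a)) => a b ab.
have svE a' b' : split_vertex (g x) (g y) (fun a => g (z^~ a)) a' b' =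
    g (fun i => split_vertex (x i) (y i) (z i) a' b').
  by rewrite /split_vertex; do 2?case: ifP.
rewrite !svE; apply: Qcl => // i; exact: zQ.
Qed.

(** The map [k] contracts the edge [{0, e}] of the complete graph on [s.+1] vertices to the vertex
    [i] of that on [s] vertices. *)
Lemma contract_clique s (e i : nat) : e <= s -> i < s -> 0 < e ->
  exists k : 'I_s.+1 -> 'I_s,
    [/\ k ord0 = i :> nat, forall a : 'I_s.+1, a = e :> nat -> k a = i :> nat
      & forall a b, a != b -> k a = k b -> 
         (a == 0 :> nat) && (b == e :> nat) || (a == e :> nat) && (b == 0 :> nat)].
Proof.
move=> es lis e0.
case: s es lis => [|s] es lis //.
pose E : 'I_s.+2 := Ordinal (es : e < s.+2).
pose i' := Ordinal lis.
pose k (a : 'I_s.+2) := if unlift E a is Some a' then tperm ord0 i' a' else i'.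
have k0 : k ord0 = i'.
  rewrite /k; case: unliftP => [j ej|/(congr1 val) /=]; last by lia.
  rewrite (_ : j = ord0) ?tpermL //; apply/val_inj.
  by move/(congr1 val): ej; rewrite /= /bump; case: leqP => /=; lia.
have kE : k E = i' by rewrite /k unlift_none.
exists k; split; first by rewrite k0.
  by move=> a ae; rewrite (_ : a = E) ?kE //; exact/val_inj.
have aux a b : a != b -> k a = k b -> b != E -> (a == E) && (b == ord0).
  move=> ab + bE; rewrite /k.
  case: (unliftP E b) bE ab => [b' ->|->]; last by rewrite eqxx.
  case: (unliftP E a) => [a' ->|->] _ ab.
    by move=> /perm_inj e'; rewrite e' eqxx in ab.
  move=> /(congr1 (tperm ord0 i')); rewrite tpermR tpermK => <-.
  rewrite eqxx /=; apply/eqP/val_inj; rewrite /= /bump.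
  by case: leqP => //; lia.
move=> a b ab kab; case: (eqVneq b E) => [bE|bE]; last first.
  by have /andP[/eqP-> /eqP->] := aux _ _ ab kab bE; rewrite /= !eqxx orbT.
have aE : a != E by rewrite -bE.
have ba : b != a by rewrite eq_sym.
have /andP[_ /eqP->] := aux _ _ ba (esym kab) aE.
by rewrite bE /= !eqxx.
Qed.

Lemma split_vertex_loop s x (z : 'I_s.+1 -> B) a b :
  split_vertex x x z a b = if a == 0 :> nat then x else z a.
Proof. by rewrite /split_vertex if_same. Qed.

Lemma split_clique_loop s (M : finType) Q (c : M -> B) x :
  @split_clique s M Q x x (fun u => c u.2) ->
  exists e : 'I_s.+1 -> B, clique (fun x y => Q x y c) e.
Proof.
move=> [z zQ]; exists (fun a : 'I_s.+1 => if a == 0 :> nat then x else z a) => a b ab.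
by have := zQ a b ab; rewrite !split_vertex_loop.
Qed.

Lemma split_clique_reflexive s (M : finType) Q (c : M -> B) : 1 < s ->
  pin_reflexive Q c -> pin_reflexive (@split_clique s M Q) (fun u => c u.2).
Proof.
move=> s1 Qrefl x y [z zQ].
have const w : (exists p, Q w w p) -> exists p, @split_clique s M Q w w p.
  move=> [p Qp]; exists (fun u => p u.2), (fun=> w) => a b _.
  by rewrite !split_vertex_loop !if_same.
have ord1P : 1 < s.+1 by lia.
split; apply: const.
  exact: (Qrefl _ _ (zQ ord0 (Ordinal ord1P) isT)).1.
have ord2P : 2 < s.+1 by lia.
exact: (Qrefl _ _ (zQ ord0 (Ordinal ord2P) isT)).1.
Qed.

Lemma split_clique_clique s (M : finType) Q (c : M -> B) (e : 'I_s -> B) :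
  1 < s -> clique (fun x y => Q x y c) e ->
  clique (fun x y => @split_clique s M Q x y (fun u => c u.2)) e.
Proof.
move=> s1 cle i j ij.
have [k [k0 k1 kI]] := contract_clique (ltnW s1) (ltn_ord j) isT.
have k0j : k ord0 = j by exact: val_inj.
have k1j (a : 'I_s.+1) : a = 1 :> nat -> k a = j by move=> /k1/val_inj.
exists (e \o k) => a b ab; rewrite /split_vertex.
have ord0E (d : 'I_s.+1) : d = 0 :> nat -> d = ord0 by move=> ?; exact: val_inj.
case: (eqVneq (a : nat) 0) ab => [/ord0E->|a0] ab.
  have /negbTE-> : b != 0 :> nat by rewrite eq_sym; exact: ab.
  case: (eqVneq (b : nat) 1) => [/k1j/= ->|b1]; first exact: cle.
  apply: cle; rewrite -k0j; apply/eqP => /(kI _ _ ab).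
  by rewrite /= (negbTE b1).
case: (eqVneq (b : nat) 0) ab => [/ord0E->|b0] ab.
  case: (eqVneq (a : nat) 1) => [/k1j/= ->|a1]; first by apply: cle; rewrite eq_sym.
  apply: cle; rewrite -k0j; apply/eqP => /(kI _ _ ab).
  by rewrite /= (negbTE a1) (negbTE a0).
apply: cle; apply/eqP => /(kI _ _ ab).
by rewrite (negbTE a0) (negbTE b0) andbF.
Qed.

(** The contracted edge turns into a loop at [e i], which may have wrong pins; all other edges have
    right ones. Different choices of the edge [d] and the loop [t] thus never spoil the same pin. *)
Lemma split_clique_tolerates s (M T : finType) Q (c : M -> B) (e : 'I_s -> B) i :
  1 < s -> clique (fun x y => Q x y c) e -> tolerates T Q c (e i) ->
  tolerates (bool * T)%type (@split_clique s M Q) (fun u => c u.2) (e i).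
Proof.
move=> s1 cle [p pQ p1].
pose v (d : bool) : nat := if d then 1 else 2.
pose E d (a b : 'I_s.+1) :=
  (a == 0 :> nat) && (b == v d :> nat) || (a == v d :> nat) && (b == 0 :> nat).
have /choice[k Hk] d : exists k : 'I_s.+1 -> 'I_s,
    [/\ k ord0 = i, forall a : 'I_s.+1, a = v d :> nat -> k a = i
      & forall a b, a != b -> k a = k b -> E d a b].
  have vs : v d <= s by rewrite /v; case: (d) => //; exact: ltnW.
  have v0 : 0 < v d by rewrite /v; case: (d).
  have [k [k0 k1 kI]] := contract_clique vs (ltn_ord i) v0.
  by exists k; split=> [|a /k1|//]; [exact: val_inj|move/val_inj].
exists (fun dt u => if E dt.1 u.1.1 u.1.2 then p dt.2 u.2 else c u.2).
  move=> [d t]; have [k0 k1 kI] := Hk d.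
  exists (fun a => e (k d a)) => a b ab /=.
  have svE (a' : 'I_s.+1) : (if a' == 0 :> nat then e i else e (k d a')) = e (k d a').
    by case: eqP => // a0; rewrite (_ : a' = ord0) ?k0 //; exact: val_inj.
  rewrite !split_vertex_loop /= !svE.
  case: (boolP (E d a b)) => [Eab|nE]; last first.
    by apply: cle; apply: contra nE => /eqP/(kI _ _ ab).
  have [-> ->] : k d a = i /\ k d b = i.
    case/orP: Eab => /andP[/eqP a0 /eqP b0].
      by rewrite (k1 b) // (_ : a = ord0) //; exact: val_inj.
    by rewrite (k1 a) // (_ : b = ord0) //; exact: val_inj.
  exact: pQ.
move=> [[a b] u] [d t] [d' t'] /=; case: ifP => // Ed pt; case: ifP => // Ed' pt'.
rewrite (p1 _ _ _ pt pt'); congr (_, _).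
move: Ed Ed'; rewrite /E /v.
by case: d; case: d' => //; lia.
Qed.

(** The outer induction increases the size [s] of the clique until [big_clique_loop] applies, the
    inner one the number [#|T|] of tolerated loops until [tolerates_loop] applies. [split_clique]
    doubles [#|T|], and a loop of it is a clique of size [s.+1]. *)
Lemma clique_loop n s : 1 < s -> m <= s + n ->
  forall (M : finType) Q (c : M -> B) (e : 'I_s -> B),
    pin_closed Q -> pin_reflexive Q c -> clique (fun x y => Q x y c) e ->
    exists u, Q u u c.
Proof.
elim: n s => [|n IH] s s1 ms M Q c e Qcl Qrefl cle.
  have ms' : m <= s by lia.
  apply: (big_clique_loop (e := fun i => e (widen_ord ms' i))) => // i j ij.
  exact: cle.
suff tol n' : forall (M T : finType) Q (c : M -> B) (e : 'I_s -> B),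
    0 < #|T| -> m <= #|T| + n' -> pin_closed Q -> pin_reflexive Q c ->
    clique (fun x y => Q x y c) e -> (forall i, tolerates T Q c (e i)) ->
    exists u, Q u u c.
  have unit_gt0 : 0 < #|{: unit}| by rewrite card_unit.
  have unit_m : m <= #|{: unit}| + m by rewrite leq_addl.
  apply: (tol m M unit Q c e) => // i; have [j ij] : exists j : 'I_s, i != j.
    have s0 := ltnW s1.
    case: (eqVneq i (Ordinal s0)) => [->|]; last by eexists; eassumption.
    by exists (Ordinal s1).
  have [[p Qp] _] := Qrefl _ _ (cle _ _ ij).
  by exists (fun=> p) => // u [] [].
elim: n' => [|n' IHn'] {Qcl Qrefl cle}M T {}Q {}c {}e T0 mT Qcl Qrefl cle tol.
  have s0 := ltnW s1.
  exists (e (Ordinal s0)); apply: (tolerates_loop Qcl _ (tol _)).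
  by rewrite addn0 in mT.
have bT : #|{: bool * T}| = #|T|.*2 by rewrite card_prod card_bool mul2n.
have bT0 : 0 < #|{: bool * T}| by rewrite bT double_gt0.
have bTm : m <= #|{: bool * T}| + n' by rewrite bT; lia.
have [u Qu] := IHn' _ _ _ (fun u => c u.2) e bT0 bTm
  (split_clique_closed (s := s) Qcl) (split_clique_reflexive s1 Qrefl)
  (split_clique_clique s1 cle) (fun i => split_clique_tolerates s1 cle (tol i)).
have [e' cle'] := split_clique_loop Qu.
by apply: (IH s.+1) cle'; rewrite ?ltnS //; lia.
Qed.

(* The square of [W] has the 2-clique [{x0, x2}]; a loop of the square is a
   2-clique of [W]. *)
Lemma square_loop (M : finType) Q (c : M -> B) (x0 x1 x2 x3 : B) :
  pin_closed Q -> pin_reflexive Q c ->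
  Q x0 x1 c -> Q x1 x2 c -> Q x2 x3 c -> Q x3 x0 c -> exists u, Q u u c.
Proof.
move=> Qcl Qrefl Q01 Q12 Q23 Q30.
have two (M' : finType) Q' (c' : M' -> B) x y : pin_closed Q' ->
    pin_reflexive Q' c' -> Q' x y c' -> Q' y x c' -> exists u, Q' u u c'.
  move=> Qcl' Qrefl' xy yx.
  apply: (@clique_loop m 2 isT (leq_addl _ _) M' Q' c'
    (fun i : 'I_2 => if i == ord0 then x else y)) => // i j.
  case: (eqVneq i ord0) => [i0|i0]; case: (eqVneq j ord0) => [j0|j0] //.
    by rewrite i0 j0 eqxx.
  have := ltn_ord i; have := ltn_ord j; move: i0 j0.
  by rewrite -!val_eqE /=; lia.
pose Q2 x y (p : bool * M -> B) :=
  exists2 z, Q x z (fun u => p (true, u)) & Q z y (fun u => p (false, u)).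
have Q2cl : pin_closed Q2.
  move=> g Cg x y p pQ.
  have /choice[z zQ] i : exists z,
      Q (x i) z (fun u => p i (true, u)) /\ Q z (y i) (fun u => p i (false, u)).
    by have [z ? ?] := pQ i; exists z.
  by exists (g z); apply: Qcl => // i; case: (zQ i).
have Q2refl : pin_reflexive Q2 (fun u => c u.2).
  move=> x y [z xz zy]; split.
    by have [[p Qp] _] := Qrefl _ _ xz; exists (fun u => p u.2), x.
  by have [_ [p Qp]] := Qrefl _ _ zy; exists (fun u => p u.2), y.
have [||u [z uz zu]] := two _ _ _ x0 x2 Q2cl Q2refl.
- by exists x1.
- by exists x3.
exact: two uz zu.
Qed.

End NearUnanimity.

(** * Extending partial solutions *)

Lemma ordS4 (i : 'I_4) (j := ordS i) (l := ordS j) (n := ordS l) :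
  [/\ [/\ j != i, l != i & n != i], [/\ j != l, j != n & l != n]
    & forall i', i' != i -> [|| i' == j, i' == l | i' == n]].
Proof.
rewrite {}/n {}/l {}/j; case: i => [[|[|[|[|//]]]] ilt];
  by split; [split|split|case=> [[|[|[|[|//]]]] ?]].
Qed.

Lemma cycle4 (T : Type) (R : 'I_4 -> T -> T -> Prop) j w0 w1 w2 w3 :
  R j w0 w1 -> R (ordS j) w1 w2 -> R (ordS (ordS j)) w2 w3 ->
  R (ordS (ordS (ordS j))) w3 w0 ->
  exists u : 'I_4 -> T, forall j', R j' (u j') (u (ordS j')).
Proof.
move=> R0 R1 R2 R3; have [[n1 n2 n3] [n12 n13 n23] cover] := ordS4 j.
have ordSS : ordS (ordS (ordS (ordS j))) = j.
  by apply/val_inj; case: (j) => [[|[|[|[|//]]]] ?].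
have e21 : (ordS (ordS j) == ordS j) = false by rewrite eq_sym (negbTE n12).
have e31 : (ordS (ordS (ordS j)) == ordS j) = false.
  by rewrite eq_sym (negbTE n13).
have e32 : (ordS (ordS (ordS j)) == ordS (ordS j)) = false.
  by rewrite eq_sym (negbTE n23).
exists (fun i => if i == j then w0 else if i == ordS j then w1
                 else if i == ordS (ordS j) then w2 else w3) => i.
rewrite /=; case: (eqVneq i j) => [->|/cover/or3P[]/eqP->].
- by rewrite (negbTE n1) eqxx.
- by rewrite eqxx (negbTE n2) e21 eqxx.
- by rewrite e21 eqxx (negbTE n3) e31 e32.
by rewrite e31 e32 ordSS eqxx.
Qed.

Lemma superset_card (V : finType) (S W : {set V}) n : S \subset W -> #|S| <= n <= #|W| ->
  exists K : {set V}, [/\ S \subset K, K \subset W & #|K| = n].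
Proof.
move=> SW /andP[Sn nW]; have [d] : exists d, d = n - #|S| by eexists.
elim: d S SW Sn => [|d IH] S SW Sn dE.
  by exists S; split=> //; apply/eqP; rewrite eqn_leq Sn -subn_eq0 -dE.
have : S \proper W by rewrite properEcard SW; lia.
case/properP=> _ [v vW vS].
have cS : #|v |: S| = #|S|.+1 by rewrite cardsU1 vS.
have [||| K [SK KW KE]] := IH (v |: S).
- by rewrite subUset sub1set vW.
- by rewrite cS; lia.
- by rewrite cS; lia.
by exists K; split=> //; apply: subset_trans SK; exact: subsetUr.
Qed.

Section PartialConsistency.

Variables (B : Type) (k : nat) (Clo : (('I_k.+2 -> B) -> B) -> Prop).
Hypothesis k_gt1 : 1 < k.
Hypothesis Clo_idem : forall g, Clo g -> forall a, g (fun=> a) = a.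
Hypothesis Clo_nu : forall (J : finType) (F : 'I_k.+2 -> J -> B),
  exists2 g, Clo g &
    forall j i0 c, (forall i, i != i0 -> F i j = c) -> g (F^~ j) = c.

(* [wk S f], meaningful for [#|S| <= k], says that the restriction of [f] to
   [S] is permitted by the constraints. *)
Variables (V : finType) (wk : {set V} -> (V -> B) -> Prop).
Hypothesis wk_local : forall (S : {set V}) f f', {in S, f =1 f'} -> wk S f -> wk S f'.
Hypothesis wk_sub : forall (S S' : {set V}) f,
  S' \subset S -> #|S| <= k -> wk S f -> wk S' f.
Hypothesis wk_closed : forall S : {set V}, #|S| <= k -> op_closed Clo (wk S).

Definition sol (W : {set V}) (f : V -> B) : Prop :=
  forall S : {set V}, S \subset W -> #|S| <= k -> wk S f.

Definition extendable (W : {set V}) : Prop :=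
  forall (S : {set V}) f, S \subset W -> #|S| <= k -> wk S f ->
  exists2 f', {in S, f =1 f'} & sol W f'.

Lemma sol_sub (W W' : {set V}) f : W' \subset W -> sol W f -> sol W' f.
Proof. by move=> sW Wf S /subset_trans/(_ sW); exact: Wf. Qed.

Lemma sol_closed W : op_closed Clo (sol W).
Proof. by move=> g Cg F solF S SW Sk; apply: wk_closed => // i; exact: solF. Qed.

(** * The induction step from smaller sets to [W] *)

Section Step.

Variables (W K : {set V}) (t : V -> B).
Hypothesis IHW : forall W' : {set V}, #|W'| < #|W| -> extendable W'.
Hypothesis sKW : K \subset W.
Hypothesis cardK : #|K| = k.
Hypothesis cardW : k.+1 < #|W|.
Hypothesis wkt : wk K t.

Let X := W :\: K.

(** Off [K] all hyperedges read the common values [f]; on [K] each may read values [p] of its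
    own. *)
Definition mix (p f : V -> B) (v : V) : B := if v \in K then p v else f v.

Lemma in_X v : v \in X -> v \in W /\ v \notin K.
Proof. by rewrite inE => /andP[]. Qed.

Lemma card_X : #|W| = k + #|X|.
Proof. by rewrite -cardK -(cardsID K W) (setIidPr sKW). Qed.

Lemma mix_local p f p' f' (S : {set V}) :
  {in S :&: K, p =1 p'} -> {in S :\: K, f =1 f'} ->
  {in S, mix p f =1 mix p' f'}.
Proof.
move=> pp ff v vS; rewrite /mix; case: ifP => vK.
  by apply: pp; rewrite inE vS.
by apply: ff; rewrite inE vS vK.
Qed.

(* For a fixed [a], the [k]-tuples [(t|_(K :\ i), a)] all extend to [W :\ i]. *)
Lemma star x : x \in X -> exists a, forall i, i \in K -> exists f,
  [/\ f x = a, sol X f &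
      forall Z L : {set V}, Z \subset X -> L \subset K -> #|Z| + #|L| <= k ->
        i \notin L \/ Z \subset [set x] -> wk (Z :|: L) (mix t f)].
Proof.
move=> xX; have [xW xK] := in_X xX.
have cxK : #|x |: K| = k.+1 by rewrite cardsU1 xK cardK.
have cxKW : #|x |: K| < #|W| by rewrite cxK.
have [r tr solr] := IHW cxKW (subsetUr [set x] K) (eq_leq cardK) wkt.
exists (r x) => i iK.
have cS : #|x |: K :\ i| = k.
  by rewrite cardsU1 !inE negb_and xK orbT -cardK (cardsD1 i K) iK.
have cWi : #|W :\ i| < #|W| by rewrite (cardsD1 i W) (subsetP sKW).
have sS : x |: K :\ i \subset W :\ i.
  rewrite subUset sub1set !inE xW andbT; apply/andP; split.
    by apply: contraNneq xK => ->.
  exact: setSD.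
have wS : wk (x |: K :\ i) r.
  by apply: solr; rewrite ?cS // setUS // subsetDl.
have [f rf solf] := IHW cWi sS (eq_leq cS) wS.
have fx : f x = r x by rewrite -rf // setU11.
have sXWi : X \subset W :\ i.
  by apply/subsetP => v /in_X[vW vK]; rewrite !inE vW andbT; apply: contraNneq vK => ->.
exists f; split=> //; first exact: sol_sub solf.
move=> Z L ZX LK ZLk iL.
have cZL : #|Z :|: L| <= k by apply: leq_trans ZLk; exact: leq_card_setU.
have ZK v : v \in Z -> v \notin K by move/(subsetP ZX)/in_X => [].
(* If [i] is not in [L], the solution [f] on [W :\ i] serves; otherwise the set lies within
   [x |: K], where [r] serves. *)
case: iL => [iL|Zx].
  apply: (wk_local (f := f)); last first.
    apply: solf => //; rewrite subUset (subset_trans ZX) //=.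
    apply/subsetP => v vL; rewrite !inE (subsetP sKW) ?(subsetP LK) // andbT.
    by apply: contraNneq iL => <-.
  move=> v; rewrite inE /mix => vZL; case: ifP => // vK.
  have vL : v \in L by case/orP: vZL => // /ZK; rewrite vK.
  rewrite -rf ?tr // !inE vK andbT; apply/orP; right.
  by apply: contraNneq iL => <-.
apply: (wk_local (f := r)); last first.
  by apply: solr => //; apply: setUSS.
move=> v; rewrite inE /mix => vZL; case: ifP => vK; first by rewrite tr.
case/orP: vZL => [|/(subsetP LK)]; last by rewrite vK.
by move=> /(subsetP Zx)/set1P->.
Qed.

(* A pattern consists of hyperedges [h] with trace [Z h] on [X] and of pins
   [(h, v)], which attach to [h] a private copy of [v \in K] of value [t v]. *)
Definition labels (H : finType) (P : {set H * V}) (h : H) : {set V} :=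
  [set v | (h, v) \in P].

Definition pattern (H : finType) (Z : H -> {set V}) (P : {set H * V}) : Prop :=
  forall h, [/\ Z h \subset X, labels P h \subset K
              & #|Z h| + #|labels P h| <= k].

Definition solved (H : finType) (Z : H -> {set V}) (P : {set H * V}) : Prop :=
  exists2 f, sol X f & forall h, wk (Z h :|: labels P h) (mix t f).

(** Removing a point from a trace frees [2 * 3 ^ (#|Z h|.-1)] for each pin on it. With base 3 this
    pays for one new pin on the reduced trace, or on a singleton trace if [1 < #|Z h|]. *)
Definition weight (H : finType) (Z : H -> {set V}) (P : {set H * V}) : nat :=
  \sum_(p in P) 3 ^ #|Z p.1|.

Lemma pattern_card (H : finType) (Z : H -> {set V}) P h :
  pattern Z P -> #|Z h :|: labels P h| <= k.
Proof. by move=> /(_ h)[_ _]; apply: leq_trans; exact: leq_card_setU. Qed.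

Lemma labels_sub (H : finType) (P P' : {set H * V}) h :
  P' \subset P -> labels P' h \subset labels P h.
Proof. by move=> sP; apply/subsetP => v; rewrite !inE; exact: (subsetP sP). Qed.

(** [Z :|: L] is smaller than [W], so the values on [L] outside [M] can be chosen anew. This turns
    solutions with few pins into members of the closed systems to which [baker_pixley] applies. *)
Lemma unpin (Z L M : {set V}) f : Z \subset X -> L \subset K -> M \subset L ->
  #|Z :|: L| <= k -> wk (Z :|: M) (mix t f) ->
  exists2 p, {in M, p =1 t} & wk (Z :|: L) (mix p f).
Proof.
move=> ZX LK ML cZL wkM.
have sMZL : Z :|: M \subset Z :|: L by rewrite setUS.
have cZM : #|Z :|: M| <= k by apply: leq_trans cZL; exact: subset_leq_card.
have cZLW : #|Z :|: L| < #|W| by lia.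
have [p fp solp] := IHW cZLW sMZL cZM wkM.
exists p => [v vM|].
  by rewrite -fp ?inE ?vM ?orbT // /mix (subsetP LK) // (subsetP ML).
apply: (wk_local (f := p)); last exact: solp.
move=> v vZL; rewrite /mix; case: ifP => // vK.
have vZ : v \in Z.
  by move: vZL; rewrite inE => /orP[//|/(subsetP LK)]; rewrite vK.
by rewrite -fp ?inE ?vZ // /mix vK.
Qed.

Lemma star_solved (H : finType) (Z : H -> {set V}) P x i :
  pattern Z P -> x \in X -> i \in K ->
  (forall h, i \notin labels P h \/ Z h \subset [set x]) -> solved Z P.
Proof.
move=> wf xX iK iP; have [a /(_ i iK)[f [_ solf fP]]] := star xX.
by exists f => // h; have [ZX LK ZLk] := wf h; apply: fP => //; exact: iP.
Qed.

(** As [k > 1], the set [i |: X] is smaller than [W], so a permitted pair on [{x, i}] extends to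
    it. *)
Lemma bag (x i : V) g : x \in X -> i \in K -> g i = t i -> wk [set x; i] g ->
  exists f, [/\ sol X f, f x = g x &
    forall Z L : {set V}, Z \subset X -> L \subset [set i] ->
      #|Z| + #|L| <= k -> wk (Z :|: L) (mix t f)].
Proof.
move=> xX iK gi wkg; have [xW xK] := in_X xX.
have ciX : #|i |: X| < #|W|.
  by have := cardsU1 i X; have := card_X; lia.
have sub : [set x; i] \subset i |: X.
  by rewrite subUset !sub1set !in_setU xX orbT in_set1 eqxx.
have c2 : #|[set x; i]| <= k by rewrite cards2; case: eqP => _ //; exact: ltnW.
have [f fg solf] := IHW ciX sub c2 wkg.
have fi : f i = t i by rewrite -fg ?gi // !inE eqxx orbT.
exists f; split; first by apply: sol_sub solf; exact: subsetUr.
  by rewrite -fg // !inE eqxx.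
move=> Z L ZX Li ZLk; apply: (wk_local (f := f)); last first.
  apply: solf; last by apply: leq_trans ZLk; exact: leq_card_setU.
  by rewrite subUset (subset_trans ZX (subsetUr _ _)) (subset_trans Li) // subsetUl.
move=> v; rewrite inE /mix => vZL; case: ifP => // vK.
case/orP: vZL => [/(subsetP ZX)/in_X[_]|/(subsetP Li)/set1P->]; last exact: fi.
by rewrite vK.
Qed.

Definition upd (f : V -> B) (x : V) (b : B) (v : V) : B :=
  if v == x then b else f v.

(** [Z :|: L] may have [k.+1] elements but is still smaller than [W]; extending [s] without [x] to
    it gives a new value [g x]. With this value the tuple on [Z] extends to [s1] on [X], and putting
    back [s x] restores the tuple of [s] on [Z]. *)
Lemma exit_value (Z L : {set V}) x s :
  Z \subset X -> x \in Z -> L \subset K -> #|Z :\ x| + #|L| <= k ->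
  #|Z| <= k -> sol X s -> wk (Z :\ x :|: L) (mix t s) ->
  exists g s1,
    [/\ sol (Z :|: L) g, {in Z :|: L, mix t (upd s x (g x)) =1 g},
        sol X s1, s1 x = g x & wk Z (upd s1 x (s x))].
Proof.
move=> ZX xZ LK ZLk Zk sols wks.
have xX := subsetP ZX _ xZ; have [xW xK] := in_X xX.
have cS : #|Z :\ x :|: L| <= k by apply: leq_trans ZLk; exact: leq_card_setU.
have ZLE : Z :|: L = x |: (Z :\ x :|: L) by rewrite setUA setD1K.
have cW : #|Z :|: L| < #|W|.
  by have := cardsU1 x (Z :\ x :|: L); rewrite -ZLE; lia.
have sub : Z :\ x :|: L \subset Z :|: L by rewrite ZLE subsetUr.
have [g gs solg] := IHW cW sub cS wks.
have gE : {in Z :|: L, mix t (upd s x (g x)) =1 g}.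
  move=> v; rewrite ZLE in_setU1 => /predU1P[->|vS].
    by rewrite /mix /upd (negbTE xK) eqxx.
  rewrite -[RHS]gs // /mix; case: (v \in K) => //; rewrite /upd.
  case: eqP => // vx; move: vS; rewrite vx !inE eqxx /= => /(subsetP LK).
  by rewrite (negbTE xK).
have wkZ : wk Z (upd s x (g x)).
  apply: (wk_local (f := g)); last by apply: solg => //; exact: subsetUl.
  move=> v vZ; rewrite -gE ?inE ?vZ // /mix.
  by have [_ /negbTE->] := in_X (subsetP ZX _ vZ).
have cXW : #|X| < #|W| by have := card_X; lia.
have [s1 s1E sols1] := IHW cXW ZX Zk wkZ.
exists g, s1; split=> //; first by rewrite -s1E // /upd eqxx.
apply: (wk_local (f := s)); last exact: sols.
by move=> v vZ; rewrite /upd; case: eqP => [->//|/eqP vx]; rewrite -s1E // /upd (negbTE vx).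
Qed.

Lemma weight_drop (H : finType) (Z Z' : H -> {set V}) (P P' : {set H * V}) h v x :
  P' \subset P -> (h, v) \in P -> x \in Z h ->
  (forall h', Z' h' = if h' == h then Z h :\ x else Z h') ->
  weight Z' P' + 2 * 3 ^ (#|Z h|.-1) <= weight Z P.
Proof.
move=> sP hvP xZ Z'E.
apply: (@leq_trans (weight Z' P + 2 * 3 ^ (#|Z h|.-1))).
  rewrite leq_add2r /weight [leqRHS](big_setID P') /= (setIidPr sP).
  exact: leq_addr.
have cZ : #|Z h| = (#|Z h :\ x|).+1 by rewrite (cardsD1 x) xZ.
rewrite /weight (bigD1 (h, v)) //= [leqRHS](bigD1 (h, v)) //= Z'E eqxx.
have : \sum_(p in P | p != (h, v)) 3 ^ #|Z' p.1| <=
       \sum_(p in P | p != (h, v)) 3 ^ #|Z p.1|.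
  apply: leq_sum => p _; rewrite leq_pexp2l // Z'E; case: eqP => // ->.
  by rewrite subset_leq_card // subsetDl.
rewrite cZ /= expnS -(leq_add2l (3 * 3 ^ #|Z h :\ x|)).
by apply: leq_trans; rewrite addnAC -mulSn.
Qed.

(** * Unrolling the hyperedge [h0] at [x] *)

Section Roll.

Variables (H : finType) (Z : H -> {set V}) (P : {set H * V}) (h0 : H) (x : V).
Hypothesis wfP : pattern Z P.
Hypothesis xZ : x \in Z h0.

(* Unrolling the pattern at [x] gives a cyclic chain of copies of it in which
   the hyperedge [h0] of each copy is attached to the [x] of the next one;
   [link_sol M f b] says that [f] solves a copy with pins [M], where [b] is the
   value of [x] in the next copy. *)
Definition link (f : V -> B) (b : B) (h : H) : V -> B :=
  if h == h0 then upd f x b else f.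

Definition link_sol (M : {set H * V}) (f : V -> B) (b : B) : Prop :=
  sol X f /\ forall h, wk (Z h :|: labels M h) (mix t (link f b h)).

Lemma linkE f h : link f (f x) h = f.
Proof.
by rewrite /link; case: ifP => // _; apply/funext => v; rewrite /upd; case: eqP => [->|].
Qed.

Lemma ZX h : Z h \subset X. Proof. by have [] := wfP h. Qed.

Lemma card_Z h : #|Z h| <= k.
Proof. by have [_ _] := wfP h; apply: leq_trans; exact: leq_addr. Qed.

Lemma labels0 h : labels (set0 : {set H * V}) h = set0.
Proof. by apply/setP => v; rewrite !inE. Qed.

Lemma mix_X (S : {set V}) f : S \subset X -> {in S, f =1 mix t f}.
Proof. by move=> SX v /(subsetP SX)/in_X[_ /negbTE vK]; rewrite /mix vK. Qed.

Lemma link_unpinned f b : sol X f -> wk (Z h0) (upd f x b) -> link_sol set0 f b.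
Proof.
move=> solf wkf; split=> // h; rewrite labels0 setU0.
apply: (wk_local (mix_X _ (ZX h))); rewrite /link; case: eqP => [->//|_].
by apply: solf (ZX h) (card_Z h).
Qed.

Lemma link_stay M f : sol X f ->
  (forall h, wk (Z h :|: labels M h) (mix t f)) -> link_sol M f (f x).
Proof. by move=> solf fM; split=> // h; rewrite linkE. Qed.

Lemma link_stay0 f : sol X f -> link_sol set0 f (f x).
Proof.
move=> solf; apply: link_stay => // h; rewrite labels0 setU0.
by apply: (wk_local (mix_X _ (ZX h))); exact: solf (ZX h) (card_Z h).
Qed.

(* [s1] leads the chain back from the value [g x] of [x] to the value [s x]:
   the two agree with a common tuple on [Z h0 :\ x]. *)
Lemma pinned_group (M0 : {set H * V}) (L : {set V}) s :
  M0 \subset P -> labels M0 h0 \subset L -> L \subset K ->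
  #|Z h0 :\ x| + #|L| <= k -> sol X s ->
  (forall h, h != h0 -> wk (Z h :|: labels M0 h) (mix t s)) ->
  wk (Z h0 :\ x :|: L) (mix t s) ->
  exists g s1,
    [/\ sol (Z h0 :|: L) g, {in L, t =1 g}, link_sol M0 s (g x), s1 x = g x
      & link_sol set0 s1 (s x)].
Proof.
move=> sM0 M0L LK ZLk sols wkh wkh0.
have [g [s1 [solg gE sols1 s1x wkZ]]] :=
  exit_value (ZX h0) xZ LK ZLk (card_Z h0) sols wkh0.
exists g, s1; split=> //; last exact: link_unpinned.
  by move=> v vL; rewrite -gE ?inE ?vL ?orbT // /mix (subsetP LK).
split=> // h; rewrite /link; case: eqP => [->|/eqP/wkh//].
have cM0 : #|Z h0 :|: labels M0 h0| <= k.
  apply: leq_trans (pattern_card h0 wfP); apply: subset_leq_card.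
  by rewrite setUS // labels_sub.
have ML : Z h0 :|: labels M0 h0 \subset Z h0 :|: L by rewrite setUS.
apply: (wk_local (f := g)); last exact: solg.
by move=> v /(subsetP ML) vZL; rewrite gE.
Qed.

Hypothesis Z_gt1 : 1 < #|Z h0|.
Variable v0 : V.
Hypothesis v0P : (h0, v0) \in P.
Hypothesis IHP : forall (H' : finType) (Z' : H' -> {set V}) P',
  weight Z' P' < weight Z P -> pattern Z' P' -> #|P'| <= k.+1 -> solved Z' P'.

Let Z' h := if h == h0 then Z h0 :\ x else Z h.

Lemma sZ'Z h : Z' h \subset Z h.
Proof. by rewrite /Z'; case: eqP => [->|//]; exact: subsetDl. Qed.

(** The induction hypothesis solves the copy with [x] removed from [h0]; [pinned_group] puts [x]
    back with the help of one unpinned copy. *)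
Lemma solve_group (M0 : {set H * V}) : M0 \subset P -> #|M0| <= k.+1 ->
  exists s s1, [/\ sol X s, link_sol M0 s (s1 x) & link_sol set0 s1 (s x)].
Proof.
move=> sM0 cM0.
have [s sols sP] : solved Z' M0.
  apply: IHP => //.
    have := weight_drop sM0 v0P xZ (Z' := Z') (fun=> erefl).
    by have := expn_gt0 3 #|Z h0|.-1; lia.
  move=> h; have [_ PK Pk] := wfP h; split.
  - exact: subset_trans (sZ'Z h) (ZX h).
  - exact: subset_trans (labels_sub h sM0) PK.
  by apply: leq_trans Pk; apply: leq_add; apply: subset_leq_card;
    [exact: sZ'Z|exact: labels_sub].
have [_ PK Pk] := wfP h0.
have MK := subset_trans (labels_sub h0 sM0) PK.
have ZMk : #|Z h0 :\ x| + #|labels M0 h0| <= k.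
  apply: leq_trans Pk; apply: leq_add; apply: subset_leq_card.
    exact: subsetDl.
  exact: labels_sub.
have sP0 : wk (Z h0 :\ x :|: labels M0 h0) (mix t s).
  by have := sP h0; rewrite /Z' eqxx.
have sPh h : h != h0 -> wk (Z h :|: labels M0 h) (mix t s).
  by move=> hh0; have := sP h; rewrite /Z' (negbTE hh0).
have [g [s1 [_ _ ls s1x ls1]]] :=
  pinned_group sM0 (subxx (labels M0 h0)) MK ZMk sols sPh sP0.
by exists s, s1; split; rewrite ?s1x.
Qed.

Lemma bag_link h i g : (h, i) \in P -> g i = t i -> wk [set x; i] g ->
  exists f, [/\ f x = g x & link_sol [set (h, i)] f (g x)].
Proof.
move=> hiP gi wkg; have [_ /subsetP PK _] := wfP h.
have iK : i \in K by apply: PK; rewrite inE.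
have [f [solf fx fP]] := bag (subsetP (ZX h0) _ xZ) iK gi wkg.
exists f; split=> //; rewrite -fx; apply: link_stay => // h'.
have [_ _ Pk] := wfP h'; apply: fP; first exact: ZX.
  by apply/subsetP => v; rewrite !inE xpair_eqE => /andP[].
apply: leq_trans Pk; rewrite leq_add2l subset_leq_card //.
by apply: labels_sub; rewrite sub1set.
Qed.

(** The outside pin [(h1, i)] sits in the next copy. Pinning [h0] at [i] as well, for which the
    removal of [x] makes room, renders the value [g x] passed to that copy compatible with [t i],
    and [bag_link] builds the copy around this pair. *)
Lemma solve_group_next (M0 : {set H * V}) h1 i :
  M0 \subset P -> #|M0| <= k -> (h1, i) \in P ->
  exists s r s1, [/\ sol X s, link_sol M0 s (r x),
    link_sol [set (h1, i)] r (s1 x) & link_sol set0 s1 (s x)].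
Proof.
move=> sM0 cM0 h1iP.
have iK : i \in K by have [_ /subsetP PK _] := wfP h1; apply: PK; rewrite inE.
have cQ : #|(h0, i) |: M0| <= k.+1 by rewrite cardsU1 -add1n leq_add ?leq_b1.
have [_ PK Pk] := wfP h0.
have ZxE : #|Z h0| = #|Z h0 :\ x|.+1 by rewrite (cardsD1 x) xZ.
pose L := i |: labels M0 h0.
have LK : L \subset K.
  by rewrite subUset sub1set iK (subset_trans (labels_sub h0 sM0)).
have ZLk : #|Z h0 :\ x| + #|L| <= k.
  have := subset_leq_card (labels_sub h0 sM0).
  by have := cardsU1 i (labels M0 h0); rewrite -/L; lia.
have labQ h : labels ((h0, i) |: M0) h = if h == h0 then L else labels M0 h.
  apply/setP => v; rewrite !inE xpair_eqE.
  by case: eqP => [->|_] //=; rewrite !inE.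
have [s sols sP] : solved Z' ((h0, i) |: M0).
  apply: IHP => //.
    have := weight_drop sM0 v0P xZ (Z' := Z') (fun=> erefl).
    have : weight Z' ((h0, i) |: M0) <= weight Z' M0 + 3 ^ #|Z h0|.-1.
      have -> : #|Z h0|.-1 = #|Z' (h0, i).1| by rewrite /Z' eqxx ZxE.
      rewrite /weight; case: (boolP ((h0, i) \in M0)) => [iM|iM].
        by rewrite (setUidPr _) ?sub1set // leq_addr.
      by rewrite big_setU1 // addnC.
    by have := expn_gt0 3 #|Z h0|.-1; lia.
  move=> h; have [_ PKh Pkh] := wfP h; split.
  - exact: subset_trans (sZ'Z h) (ZX h).
  - by rewrite labQ; case: ifP => // _; exact: subset_trans (labels_sub h sM0) PKh.
  rewrite labQ /Z'; case: eqP => // _.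
  by apply: leq_trans Pkh; rewrite leq_add2l subset_leq_card // labels_sub.
have sP0 : wk (Z h0 :\ x :|: L) (mix t s).
  by have := sP h0; rewrite labQ /Z' eqxx.
have sPh h : h != h0 -> wk (Z h :|: labels M0 h) (mix t s).
  by move=> hh0; have := sP h; rewrite labQ /Z' (negbTE hh0).
have [g [s1 [solg gt ls s1x ls1]]] :=
  pinned_group sM0 (subsetUr [set i] _) LK ZLk sols sPh sP0.
have wkg : wk [set x; i] g.
  apply: solg; last by rewrite cards2; case: eqP => _ //; exact: ltnW.
  by rewrite subUset !sub1set !inE xZ eqxx orbT.
have iL : i \in L by rewrite setU11.
have [r [rx lr]] := bag_link h1iP (esym (gt i iL)) wkg.
by exists s, r, s1; split; rewrite ?rx ?s1x.
Qed.

(** The outside pin sits in a copy where [x] has the value [s x] again. An additional hyperedge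
    [None] with trace [[set x]] and label [i] makes this value compatible with [t i]. *)
Lemma solve_group_far (M0 : {set H * V}) h1 i :
  M0 \subset P -> #|M0| <= k -> (h1, i) \in P ->
  exists s r s1, [/\ sol X s /\ r x = s x, link_sol M0 s (s1 x),
    link_sol [set (h1, i)] r (s x) & link_sol set0 s1 (s x)].
Proof.
move=> sM0 cM0 h1iP.
have iK : i \in K by have [_ /subsetP PK _] := wfP h1; apply: PK; rewrite inE.
have [_ PK Pk] := wfP h0.
pose ZU (h : option H) := if h is Some h' then Z' h' else [set x].
pose some_pin (p : H * V) : option H * V := (Some p.1, p.2).
have some_inj : injective some_pin by move=> [? ?] [? ?] [-> ->].
pose Q := (None, i) |: [set some_pin p | p in M0].
have NQ : (None, i) \notin [set some_pin p | p in M0].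
  by apply/imsetP => -[p _] [].
have labS h : labels Q (Some h) = labels M0 h.
  apply/setP => v; rewrite !inE xpair_eqE /=.
  by rewrite -(mem_imset M0 (h, v) some_inj).
have labN : labels Q None = [set i].
  apply/setP => v; rewrite !inE xpair_eqE /= orbC.
  by case: imsetP => // -[p _] [].
have [s sols sP] : solved ZU Q.
  apply: IHP.
  - have := weight_drop sM0 v0P xZ (Z' := Z') (fun=> erefl).
    have -> : weight ZU Q = 3 + weight Z' M0.
      rewrite /weight big_setU1 //= cards1 expn1; congr (_ + _).
      by rewrite big_imset //=; exact: in2W.
    have : 3 ^ 1 <= 3 ^ #|Z h0|.-1 by rewrite leq_pexp2l //; lia.
    by rewrite expn1; lia.
  - case=> [h|]; last first.
      by rewrite labN /= !cards1 !sub1set (subsetP (ZX h0)) // iK; split.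
    have [_ PKh Pkh] := wfP h; rewrite labS; split.
    + exact: subset_trans (sZ'Z h) (ZX h).
    + exact: subset_trans (labels_sub h sM0) PKh.
    by apply: leq_trans Pkh; apply: leq_add; apply: subset_leq_card;
      [exact: sZ'Z|exact: labels_sub].
  by rewrite cardsU1 NQ card_imset //; lia.
have MK := subset_trans (labels_sub h0 sM0) PK.
have ZMk : #|Z h0 :\ x| + #|labels M0 h0| <= k.
  apply: leq_trans Pk; apply: leq_add; apply: subset_leq_card.
    exact: subsetDl.
  exact: labels_sub.
have sP0 : wk (Z h0 :\ x :|: labels M0 h0) (mix t s).
  by have := sP (Some h0); rewrite labS /= /Z' eqxx.
have sPh h : h != h0 -> wk (Z h :|: labels M0 h) (mix t s).
  by move=> hh0; have := sP (Some h); rewrite labS /= /Z' (negbTE hh0).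
have [g [s1 [_ _ ls s1x ls1]]] :=
  pinned_group sM0 (subxx (labels M0 h0)) MK ZMk sols sPh sP0.
have [xW /negbTE xK] := in_X (subsetP (ZX h0) _ xZ).
have mti : mix t s i = t i by rewrite /mix iK.
have wkx : wk [set x; i] (mix t s) by have := sP None; rewrite labN.
have [r [rx lr]] := bag_link h1iP mti wkx.
have mtx : mix t s x = s x by rewrite /mix xK.
by exists s, r, s1; rewrite -mtx rx; split; rewrite ?s1x // mtx.
Qed.

Definition slice (M : {set 'I_4 * (H * V)}) (j : 'I_4) : {set H * V} :=
  [set p | (j, p) \in M].

Lemma card_slice (M : {set 'I_4 * (H * V)}) j :
  #|M| = #|slice M j| + #|[set e in M | e.1 != j]|.
Proof.
rewrite -(cardsID [set e | e.1 == j] M); congr (_ + _).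
  rewrite -(card_imset (slice M j) (f := pair j)); last by move=> ? ? [].
  apply: eq_card => -[j' p]; rewrite !inE /=; apply/andP/imsetP.
    by move=> [jpM /eqP jE]; exists p; rewrite ?inE -?jE.
  by move=> [p']; rewrite inE => jpM [-> ->]; rewrite eqxx.
by apply: eq_card => e; rewrite !inE andbC.
Qed.

(* By [baker_pixley] only [k+1] pins matter. If no copy carries all the labels,
   then all copies are glued at one value of [x]. Otherwise one copy carries all
   [k] labels, so at most one pin is left outside it, and the copy is solved by
   the induction hypothesis, with [x] removed from [Z h0] and one pin added to
   accommodate the pin outside. *)
Lemma chain_solution (M : {set 'I_4 * (H * V)}) :
  (forall e, e \in M -> e.2 \in P) -> #|M| <= k.+1 ->
  exists u : 'I_4 -> V -> B,
    forall j, link_sol (slice M j) (u j) (u (ordS j) x).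
Proof.
move=> MP cM; have xX := subsetP (ZX h0) _ xZ.
have sMP j : slice M j \subset P by apply/subsetP => p; rewrite inE => /MP.
have [/choice[i iP]|] := pselect (forall j, exists i, i \in K /\
    forall h, i \notin labels (slice M j) h).
  have [a aP] := star xX.
  have /choice[u uP] j : exists f, f x = a /\ link_sol (slice M j) f a.
    have [f [fx solf fP]] := aP _ (iP j).1; exists f; split=> //.
    rewrite -fx; apply: link_stay => // h; apply: fP; first exact: ZX.
    - by have [_ PK _] := wfP h; exact: subset_trans (labels_sub h (sMP j)) PK.
    - have [_ _ Pk] := wfP h; apply: leq_trans Pk.
      by rewrite leq_add2l subset_leq_card // labels_sub.
    - by left; exact: (iP j).2.
  by exists u => j; rewrite (uP (ordS j)).1; exact: (uP j).2.
move=> /existsNP[j0 /forallNP jK].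
have sK : K \subset [set p.2 | p in slice M j0].
  apply/subsetP => i iK; apply: contrapT => ni; apply: (jK i); split=> // h.
  by apply/negP; rewrite inE => hi; apply: ni; apply/imsetP; exists (h, i).
have ck : k <= #|slice M j0|.
  by rewrite -cardK; apply: leq_trans (subset_leq_card sK) (leq_imset_card _ _).
have cE := card_slice M j0; set E := [set e in M | _] in cE.
have sliceE j p : j != j0 -> (p \in slice M j) = ((j, p) \in E).
  by move=> jj0; rewrite !inE jj0 andbT.
have [[n1 n2 n3] [n12 n13 n23] ordS_cover] := ordS4 j0.
case: (set_0Vmem E) => [E0|[[j1 [h1 i]] eE]].
  have sl0 j : j != j0 -> slice M j = set0.
    by move=> jj0; apply/setP => p; rewrite sliceE // E0 !inE.
  have cS : #|slice M j0| <= k.+1 by apply: leq_trans cM; rewrite cE leq_addr.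
  have [s [s1 [sols l0 l1]]] := solve_group (sMP j0) cS.
  apply: (cycle4 (R := fun j f f' => link_sol (slice M j) f (f' x))
    (j := j0) (w0 := s) (w1 := s1) (w2 := s) (w3 := s)) => //=;
    by rewrite sl0 //; exact: link_stay0.
have E1 : E = [set (j1, (h1, i))].
  apply/eqP; rewrite eq_sym eqEcard sub1set eE cards1 /=.
  by rewrite -(leq_add2l #|slice M j0|) -cE addn1 (leq_trans cM).
have hiP : (h1, i) \in P by apply: (MP (j1, (h1, i))); move: eE; rewrite inE => /andP[].
have slE j : j != j0 -> slice M j = if j == j1 then [set (h1, i)] else set0.
  move=> jj0; apply/setP => p; rewrite sliceE // E1 in_set1 xpair_eqE.
  by case: eqP => _; rewrite ?in_set1 ?in_set0.
have cM0 : #|slice M j0| <= k.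
  by move: cM; rewrite cE E1 cards1 addn1.
have j1j0 : j1 != j0 by move: eE; rewrite inE => /andP[].
case/or3P: (ordS_cover _ j1j0) => /eqP j1E.
- have [s [r [s1 [sols l0 lr l1]]]] := solve_group_next (sMP j0) cM0 hiP.
  apply: (cycle4 (R := fun j f f' => link_sol (slice M j) f (f' x))
    (j := j0) (w0 := s) (w1 := r) (w2 := s1) (w3 := s)) => //=;
    rewrite slE // j1E ?eqxx // eq_sym ?(negbTE n12) ?(negbTE n13) //.
  exact: link_stay0.
- have [s [r [s1 [[sols rx] l0 lr l1]]]] := solve_group_far (sMP j0) cM0 hiP.
  apply: (cycle4 (R := fun j f f' => link_sol (slice M j) f (f' x))
    (j := j0) (w0 := s) (w1 := s1) (w2 := r) (w3 := s)) => //=;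
    rewrite slE // j1E ?eqxx ?(negbTE n12) ?rx //.
  by rewrite eq_sym (negbTE n23); exact: link_stay0.
have [s [r [s1 [[sols rx] l0 lr l1]]]] := solve_group_far (sMP j0) cM0 hiP.
apply: (cycle4 (R := fun j f f' => link_sol (slice M j) f (f' x))
  (j := j0) (w0 := s) (w1 := s1) (w2 := s) (w3 := r)) => //=;
  rewrite slE // j1E ?eqxx ?(negbTE n13) ?rx //.
by rewrite (negbTE n23); exact: link_stay0.
Qed.

(** At the pins [t], the four copies form a closed walk in this relation, and a loop of it is a
    solution of the pattern. *)
Definition rolled (a b : B) (p : H * V -> B) : Prop :=
  exists f, [/\ sol X f, f x = a & forall h,
    wk (Z h :|: labels P h) (mix (fun v => p (h, v)) (link f b h))].

Lemma rolled_closed : pin_closed Clo rolled.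
Proof.
move=> g Cg a b p /choice[f fP].
exists (fun v => g (f^~ v)); split.
- by apply: sol_closed => // i; case: (fP i).
- by congr g; apply/funext => i; case: (fP i).
move=> h; have cZ := pattern_card h wfP.
have := wk_closed cZ Cg (F := fun i => mix (fun v => p i (h, v)) (link (f i) (b i) h)).
have -> : (fun j => g (fun i => mix (fun v => p i (h, v)) (link (f i) (b i) h) j)) =
    mix (fun v => g (fun i => p i (h, v))) (link (fun v => g (f^~ v)) (g b) h).
  apply/funext => v; rewrite /mix /link /upd.
  by case: (v \in K); case: (h == h0); case: (v == x).
by apply=> i; case: (fP i).
Qed.

Lemma rolled_refl f : sol X f -> exists p, rolled (f x) (f x) p.
Proof.
move=> solf.
have /choice[p pP] h : exists p, wk (Z h :|: labels P h) (mix p f).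
  have [_ PK _] := wfP h.
  have [|p _ ?] := unpin (ZX h) PK (sub0set _) (pattern_card h wfP) (f := f).
    by rewrite setU0; apply: (wk_local (mix_X _ (ZX h))); exact: solf (ZX h) (card_Z h).
  by exists p.
exists (fun hv => p hv.1 hv.2), f; split=> // h.
by rewrite linkE; exact: pP.
Qed.

(** The value [a] belongs to [f]; the value [b] is permitted at [x] by [h0], so it too is the value
    at [x] of a solution on [X]. *)
Lemma rolled_reflexive : pin_reflexive rolled (fun p => t p.2).
Proof.
move=> a b [f [solf <- fP]]; split; first exact: rolled_refl.
have xX := subsetP (ZX h0) _ xZ; have [_ /negbTE xK] := in_X xX.
have x1 : [set x] \subset X by rewrite sub1set.
have cx : #|[set x]| <= k by rewrite cards1 ltnW.
have cXW : #|X| < #|W| by have := card_X; lia.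
have wkx : wk [set x] (fun=> b).
  apply: (wk_local (f := mix t (link f b h0))).
    by move=> v /set1P->; rewrite /mix xK /link eqxx /upd eqxx.
  apply: wk_sub (fP h0); last exact: pattern_card.
  by rewrite sub1set inE xZ.
have [f' f'b solf'] := IHW cXW x1 cx wkx.
by rewrite (f'b x (set11 x)); exact: rolled_refl.
Qed.

Lemma roll : solved Z P.
Proof.
(* The left summand carries the values of the copies; the right one carries the private copies of
   the labels, the only entries to be prescribed. *)
pose J : finType := ('I_4 * V + 'I_4 * (H * V))%type.
pose s (F : J -> B) j v := F (inl (j, v)).
pose p (F : J -> B) j h v := F (inr (j, (h, v))).
pose PJ (F : J -> B) := forall j, sol X (s F j) /\ forall h,
  wk (Z h :|: labels P h) (mix (p F j h) (link (s F j) (s F (ordS j) x) h)).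
have PJ_closed : op_closed Clo PJ.
  move=> g Cg F PF j; split.
    by apply: sol_closed => // i; exact: (PF i j).1.
  move=> h; have cZ := pattern_card h wfP.
  have := wk_closed cZ Cg (F := fun i => mix (p (F i) j h)
    (link (s (F i) j) (s (F i) (ordS j) x) h)).
  set f1 := (X in _ -> wk _ X); set f2 := (X in (_ -> wk _ X) -> _).
  have -> : f2 = f1.
    apply/funext => v; rewrite /f1 /f2 /mix /link /upd.
    by case: (v \in K); case: (h == h0); case: (v == x).
  by apply=> i; exact: (PF i j).2.
pose c (e : J) := match e with inl (_, v) => t v | inr (_, (_, v)) => t v end.
pose M0 : {set J} := [set e | if e is inr (_, q) then q \in P else false].
have [M sM cM|F PF Fc] := baker_pixley (m := k.+2) isT Clo_nu (M0 := M0) (c := c) PJ_closed.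
  pose M' := [set e | (inr e : J) \in M].
  have M'P e : e \in M' -> e.2 \in P.
    by case: e => j q; rewrite inE => /(subsetP sM); rewrite inE.
  have cM' : #|M'| <= k.+1.
    rewrite -(card_imset M' (f := inr : _ -> J)); last by move=> ? ? [].
    apply: (@leq_trans #|M|); last exact: cM.
    by apply: subset_leq_card; apply/subsetP => _ /imsetP[e + ->]; rewrite inE.
  have [u uP] := chain_solution M'P cM'.
  have /choice[q qP] (jh : 'I_4 * H) : exists q, {in labels (slice M' jh.1) jh.2, q =1 t} /\
      wk (Z jh.2 :|: labels P jh.2)
        (mix q (link (u jh.1) (u (ordS jh.1) x) jh.2)).
    case: jh => j h /=; have [_ PK _] := wfP h.
    have ML : labels (slice M' j) h \subset labels P h.
      by apply: labels_sub; apply/subsetP => e; rewrite inE => /M'P.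
    have [q ? ?] := unpin (ZX h) PK ML (pattern_card h wfP) ((uP j).2 h).
    by exists q.
  exists (fun e => match e with inl (j, v) => u j v | inr (j, (h, v)) => q (j, h) v end).
    by move=> j; split; [exact: (uP j).1|move=> h; exact: (qP (j, h)).2].
  move=> [[j v]|[j [h v]]] eM /=; first by have := subsetP sM _ eM; rewrite inE.
  by apply: (qP (j, h)).1; rewrite !inE.
have step j : rolled (s F j x) (s F (ordS j) x) (fun p => t p.2).
  exists (s F j); split=> //; first exact: (PF j).1.
  move=> h; apply: wk_local ((PF j).2 h); apply: mix_local => // v.
  rewrite !inE => /andP[/orP[/(subsetP (ZX h))/in_X[_ /negbTE->]//|hvP] vK].
  by rewrite /p (Fc (inr (j, (h, v)))) // inE.
have ordSS : ordS (ordS (ordS (ordS ord0))) = ord0 :> 'I_4 by exact/val_inj.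
have := step (ordS (ordS (ordS ord0))); rewrite ordSS => step3.
have [a [f [solf fx fP]]] := square_loop (isT : 1 < k.+2) Clo_idem Clo_nu rolled_closed
  rolled_reflexive (step ord0) (step _) (step _) step3.
by exists f => // h; have := fP h; rewrite -fx linkE.
Qed.

End Roll.

(* Some label [i] is pinned at most once, say in [h0]. If [Z h0] has at most one
   element, then [star] applies; otherwise [h0] can be unrolled. *)
Lemma solved_small n (H : finType) (Z : H -> {set V}) P :
  weight Z P < n -> pattern Z P -> #|P| <= k.+1 -> solved Z P.
Proof.
elim: n H Z P => [//|n IH] H Z P wn wfP cP.
have [x xX] : exists x, x \in X.
  by apply/set0Pn; rewrite -card_gt0; have := card_X; lia.
have [i [iK ui]] : exists i, i \in K /\ #|[set p in P | p.2 == i]| <= 1.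
  apply: contrapT => /forallNP no.
  (* Otherwise every label is pinned at least twice, and [2 * k] exceeds [k.+1] as [k > 1]. *)
  suff : #|K| * 2 <= #|P| by rewrite cardK; lia.
  rewrite -sum_nat_const.
  apply: (@leq_trans (\sum_(i in K) #|[set p in P | p.2 == i]|)).
    apply: leq_sum => i iK; rewrite ltnNge; apply/negP => ui.
    by apply: (no i); split.
  have -> : \sum_(i in K) #|[set p in P | p.2 == i]| =
      \sum_(i in K) \sum_(p in P | p.2 == i) 1.
    by apply: eq_bigr => i _; rewrite -sum1_card; apply: eq_bigl => p; rewrite inE.
  rewrite (exchange_big_dep (mem P)) /=; last by move=> ? ? _ /andP[].
  rewrite -sum1_card; apply: leq_sum => p _.
  have -> : \sum_(j in K | (p \in P) && (p.2 == j)) 1 =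
      \sum_(j | (j \in K) && (p \in P) && (p.2 == j)) 1.
    by apply: eq_bigl => j; rewrite andbA.
  rewrite sum1_card; apply: leq_trans (_ : #|[set p.2]| <= 1); last by rewrite cards1.
  by apply: subset_leq_card; apply/subsetP => j; rewrite !inE => /andP[_ /eqP->].
case: (set_0Vmem [set p in P | p.2 == i]) => [P0|[[h0 i'] hP]].
  apply: (star_solved wfP xX iK) => h; left; rewrite inE.
  apply/negP => hiP; have : (h, i) \in [set p in P | p.2 == i] by rewrite inE hiP /=.
  by rewrite P0 inE.
have i'i : i' = i by move: hP; rewrite inE => /andP[_ /eqP].
rewrite {i'}i'i in hP; have hiP : (h0, i) \in P by move: hP; rewrite inE => /andP[].
have uniq_h h : h != h0 -> i \notin labels P h.
  move=> hh0; apply: contraNN hh0; rewrite inE => hi.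
  have hi' : (h, i) \in [set p in P | p.2 == i] by rewrite inE hi /=.
  by have [->] := card_le1_eqP ui _ _ hP hi'.
have [ZX _ _] := wfP h0.
case: (leqP #|Z h0| 1) => [Z1|Z2]; last first.
  have [y yZ] : exists y, y \in Z h0 by apply/set0Pn; rewrite -card_gt0 ltnW.
  apply: (roll wfP yZ Z2 hiP) => H' Z' P' w'.
  by apply: IH; apply: leq_trans w' _; rewrite -ltnS.
have [y yX Zy] : exists2 y, y \in X & Z h0 \subset [set y].
  case: (set_0Vmem (Z h0)) => [->|[y yZ]]; first by exists x; rewrite ?sub0set.
  exists y; first exact: (subsetP ZX).
  by apply/subsetP => z zZ; rewrite inE; apply/eqP; exact: (card_le1_eqP Z1).
apply: (star_solved wfP yX iK) => h.
by case: (eqVneq h h0) => [->|/uniq_h]; [right|left].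
Qed.

(** [baker_pixley] reduces this to at most [k.+1] pins, where [solved_small] applies. *)
Lemma solved_pattern (H : finType) (Z : H -> {set V}) P :
  pattern Z P -> solved Z P.
Proof.
move=> wfP; pose J : finType := (V + H * V)%type.
pose PJ (F : J -> B) := sol X (fun v => F (inl v)) /\ forall h,
  wk (Z h :|: labels P h) (mix (fun v => F (inr (h, v))) (fun v => F (inl v))).
have PJ_closed : op_closed Clo PJ.
  move=> g Cg F PF; split; first by apply: sol_closed => // i; exact: (PF i).1.
  move=> h; have cZ := pattern_card h wfP.
  have := wk_closed cZ Cg (F := fun i => mix (fun v => F i (inr (h, v)))
    (fun v => F i (inl v))).
  set f1 := (X in _ -> wk _ X); set f2 := (X in (_ -> wk _ X) -> _).
  have -> : f2 = f1 by apply/funext => v; rewrite /f1 /f2 /mix; case: (v \in K).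
  by apply=> i; exact: (PF i).2.
pose c (e : J) := match e with inl v => t v | inr (_, v) => t v end.
pose M0 : {set J} := [set e | if e is inr q then q \in P else false].
have [M sM cM|F [solF FP] Fc] :=
    baker_pixley (m := k.+2) isT Clo_nu (M0 := M0) (c := c) PJ_closed.
  pose P' := [set q | (inr q : J) \in M].
  have P'P : P' \subset P.
    by apply/subsetP => q; rewrite inE => /(subsetP sM); rewrite inE.
  have cP' : #|P'| <= k.+1.
    rewrite -(card_imset P' (f := inr : _ -> J)); last by move=> ? ? [].
    apply: (@leq_trans #|M|); last exact: cM.
    by apply: subset_leq_card; apply/subsetP => _ /imsetP[e + ->]; rewrite inE.
  have wfP' : pattern Z P'.
    move=> h; have [ZX PK Pk] := wfP h; split=> //.
      exact: subset_trans (labels_sub h P'P) PK.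
    by apply: leq_trans Pk; rewrite leq_add2l subset_leq_card // labels_sub.
  have [f solf fP] := solved_small (ltnSn _) wfP' cP'.
  have /choice[q qP] h : exists q, {in labels P' h, q =1 t} /\
      wk (Z h :|: labels P h) (mix q f).
    have [ZX PK _] := wfP h.
    have [q ? ?] := unpin ZX PK (labels_sub h P'P) (pattern_card h wfP) (fP h).
    by exists q.
  exists (fun e => match e with inl v => f v | inr (h, v) => q h v end).
    by split=> // h; exact: (qP h).2.
  move=> [v|[h v]] eM /=; first by have := subsetP sM _ eM; rewrite inE.
  by apply: (qP h).1; rewrite !inE.
exists (fun v => F (inl v)) => // h; have [ZX _ _] := wfP h.
apply: wk_local (FP h); apply: mix_local => // v.
rewrite !inE => /andP[/orP[/(subsetP ZX)/in_X[_ /negbTE->]//|hvP] _].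
by rewrite (Fc (inr (h, v))) // inE.
Qed.

Lemma extend_tuple : exists2 f, {in K, t =1 f} & sol W f.
Proof.
(* Every subset of [W] of size at most [k] becomes a hyperedge with its trace off [K] and its pins
   on [K]; other sets get an empty trace and no pins. *)
pose ok (C : {set V}) := (C \subset W) && (#|C| <= k).
pose Z C := if ok C then C :&: X else set0.
pose P : {set {set V} * V} := [set p | ok p.1 && (p.2 \in p.1 :&: K)].
have labE C : labels P C = if ok C then C :&: K else set0.
  by apply/setP => v; rewrite !inE /=; case: ifP; rewrite !inE.
have ZL C : ok C -> Z C :|: labels P C = C.
  move=> okC; rewrite labE /Z okC -setIUr /X setUC.
  case/andP: okC => CW _; apply/setIidPl/(subset_trans CW).
  by apply/subsetP => v vW; rewrite !inE vW andbT orbN.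
have [C|f solf fP] := solved_pattern (Z := Z) (P := P).
  rewrite labE /Z; case: ifP => [/andP[CW Ck]|_]; last by rewrite !sub0set !cards0.
  split; try exact: subsetIr.
  apply: leq_trans Ck; rewrite -(cardsID K C) addnC leq_add2l.
  by apply: subset_leq_card; apply/subsetP => v; rewrite !inE => /and3P[-> -> _].
exists (mix t f) => [v vK|S SW Sk]; first by rewrite /mix vK.
by rewrite -(ZL S) ?/ok ?SW //; exact: fP.
Qed.

End Step.

(** Beyond size [k.+1], a tuple on [S] is first extended to a [k]-element set [K], which is smaller
    than [W], and then by [extend_tuple]. *)
Lemma all_extendable :
  (forall W : {set V}, #|W| <= k.+1 -> extendable W) ->
  forall W, extendable W.
Proof.
move=> small W; have [n] : exists n, #|W| <= n by exists #|W|.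
elim: n W => [|n IH] W Wn; first by apply: small; lia.
case: (leqP #|W| k.+1) => [|kW]; first exact: small.
have IHW (W' : {set V}) : #|W'| < #|W| -> extendable W'.
  by move=> W'W; apply: IH; lia.
move=> S f SW Sk wkf.
have [|K [SK KW KE]] := superset_card (n := k) SW; first by rewrite Sk; lia.
have cKW : #|K| < #|W| by rewrite KE; lia.
have [t ft solt] := IHW K cKW S f SK Sk wkf.
have wkt : wk K t by apply: solt; rewrite ?KE.
have [f' tf' solf'] := extend_tuple IHW KW KE kW wkt.
by exists f' => // v vS; rewrite ft // tf' // (subsetP SK).
Qed.

End PartialConsistency.

(** * From instances to partial solutions *)

Lemma eval_term_idempotent (B : algebra) (X : Type) (t : term B X) (a : B) :
  idempotent_algebra B -> eval (fun=> a) t = a.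
Proof.
move=> idB; elim: t => [//|f ts IH] /=.
by rewrite (_ : (fun j => _) = (fun=> a)) ?idB //; apply/funext => j.
Qed.

Lemma subuniverse_eval (B : algebra) (n : nat) (R : set (power B n))
    (X : Type) (F : X -> 'I_n -> B) (t : term B X) :
  subuniverse R -> (forall x, R (F x)) -> R (fun j => eval (F^~ j) t).
Proof.
move=> subR FR; elim: t => [x|f ts IH] /=; first exact: FR.
exact: (subR f (fun l j => eval (F^~ j) (ts l))).
Qed.

Section NearUnanimitySensitive.

Variables (B : algebra) (k : nat).
Hypothesis k_gt1 : 1 < k.
Hypothesis idB : idempotent_algebra B.
Hypothesis nuB : local_near_unanimity k.+2 B.

Let Clo (g : ('I_k.+2 -> B) -> B) := term_operation g.

Lemma term_operation_idem g : Clo g -> forall a, g (fun=> a) = a.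
Proof. by move=> [t gt] a; rewrite gt eval_term_idempotent. Qed.

Lemma term_operation_nu (J : finType) (F : 'I_k.+2 -> J -> B) :
  exists2 g, Clo g &
    forall j i0 c, (forall i, i != i0 -> F i j = c) -> g (F^~ j) = c.
Proof.
pose S : set B := [set F p.1 p.2 | p in [set: 'I_k.+2 * J]]%classic.
have finS : finite_set S by apply: finite_image; exact: finite_finset.
have [g Cg gS] := nuB finS; exists g => // j i0 c Fc.
have SF i : S (F i j) by exists (i, j).
have [i1 i1i0] : exists i1, i1 != i0.
  case: (eqVneq ord0 i0) => [<-|]; last by eexists; eassumption.
  by exists ord_max.
have Sc : S c by rewrite -(Fc i1 i1i0); exact: SF.
rewrite -[RHS](gS c (F i0 j) i0 Sc (SF i0)); congr g; apply/funext => i.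
by case: eqP => [->//|/eqP/Fc].
Qed.

Variable I : instance B.
Hypothesis overI : instance_over I.
Hypothesis kkI : kk1_instance k I.

Let V := var I.

Definition dom (c : constraint V B) : {set V} := [set v in codom (scope c)].

Definition satisfies (f : V -> B) (c : constraint V B) : Prop :=
  rel_of c (fun i => f (scope c i)).

Lemma mem_scope (c : constraint V B) i : scope c i \in dom c.
Proof. by rewrite inE codom_f. Qed.

Lemma card_dom c : constraints I c -> #|dom c| = k.
Proof.
case: kkI => [[arity _ _] _] /arity[ck inj].
by rewrite cardsE card_codom // card_ord.
Qed.

Lemma satisfies_local c f f' :
  {in dom c, f =1 f'} -> satisfies f c -> satisfies f' c.
Proof.
move=> ff'; rewrite /satisfies (_ : (fun i => f _) = (fun i => f' (scope c i))) //.
by apply/funext => i; rewrite ff' ?mem_scope.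
Qed.

Lemma constraint_on (C : {set V}) : #|C| = k ->
  exists2 c, constraints I c & dom c = C.
Proof.
case: kkI => [[_ ex _] _] /ex[c Ic cC]; exists c => //.
by apply/setP => v; rewrite inE cC.
Qed.

Lemma extend_one (W : {set V}) c f : #|W| = k.+1 -> constraints I c ->
  dom c \subset W -> satisfies f c ->
  exists2 f', {in dom c, f =1 f'} &
    forall d, constraints I d -> dom d \subset W -> satisfies f' d.
Proof.
move=> cW Ic cWs fc; case: kkI => _ /(_ W cW) sensW.
have lower d : constraints I d -> dom d \subset W ->
    exists2 d' : constraint {x : V | x \in W} B,
      constraints (restriction W) d' & rename_scope val d' = d.
  case: d => n sc r Id dW.
  have scW i : sc i \in W.
    exact: (subsetP dW _ (@mem_scope (Constraint sc r) i)).
  by exists (Constraint (fun i => exist (fun x => x \in W) (sc i) (scW i)) r).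
have [c' Ic' c'E] := lower c Ic cWs.
rewrite -{}c'E in fc *.
have [h solh hc] := sensW c' Ic' _ fc.
pose f' v := if insub v is Some u then h u else f v.
have f'E (u : {x : V | x \in W}) : f' (val u) = h u by rewrite /f' valK.
exists f'.
  by move=> v; rewrite inE => /codomP[i ->] /=; rewrite f'E hc.
move=> d Id dW; have [d' Id' <-] := lower d Id dW.
rewrite /satisfies /=.
rewrite (_ : (fun i => _) = (fun i => h (scope d' i))); first exact: solh.
by apply/funext => i; rewrite f'E.
Qed.

(** Induction on the number of variables of [c'] missing from [c]: one of them is exchanged for a
    variable of [c] outside [c'], within a set of size [k.+1] where [extend_one] applies. Once the
    scopes coincide, uniformity identifies the constraints. *)
Lemma transfer c c' f (S : {set V}) : constraints I c -> constraints I c' ->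
  S \subset dom c -> S \subset dom c' -> satisfies f c ->
  exists2 f', {in S, f =1 f'} & satisfies f' c'.
Proof.
have [n] : exists n, n = #|dom c' :\: dom c| by eexists.
elim: n c f => [|n IH] c f nE Ic Ic' Sc Sc' fc.
  have cc' : dom c = dom c'.
    apply/esym/eqP; rewrite eqEcard !card_dom // leqnn andbT.
    by rewrite -setD_eq0 -cards_eq0 -nE.
  case: kkI => [[_ _ same] _].
  have [|s [_ sE rE]] := same c c' Ic Ic'.
    by move=> v; move/setP: cc' => /(_ v); rewrite !inE.
  exists f => //; rewrite /satisfies.
  rewrite (_ : (fun i => _) = (fun i => f (scope c (s i)))).
    exact: (iffLR (rE (fun i => f (scope c i))) fc).
  by apply/funext => i; rewrite sE.
have [v] : exists v, v \in dom c' :\: dom c.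
  by apply/set0Pn; rewrite -card_gt0 -nE.
rewrite in_setD => /andP[vc vc'].
have [w] : exists w, w \in dom c :\: dom c'.
  apply/set0Pn; rewrite -card_gt0.
  have := cardsID (dom c') (dom c); have := cardsID (dom c) (dom c').
  by rewrite setIC !card_dom // -nE; lia.
rewrite in_setD => /andP[wc' wc].
have cW : #|v |: dom c| = k.+1 by rewrite cardsU1 vc card_dom.
have [f1 ff1 f1W] := extend_one cW Ic (subsetUr _ _) fc.
have wv : w != v by apply: contraNneq vc => <-.
have [|d Id dE] := @constraint_on ((v |: dom c) :\ w).
  by have := cardsD1 w (v |: dom c); rewrite cW in_setU1 wc orbT add1n => -[].
have f1d : satisfies f1 d by apply: f1W => //; rewrite dE subsetDl.
have Sd : S \subset dom d.
  rewrite dE subsetD1; apply/andP; split.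
    exact: subset_trans Sc (subsetUr _ _).
  by apply: contra wc' => /(subsetP Sc').
have [|f' f1f' f'c'] := IH d f1 _ Id Ic' Sd Sc' f1d.
  have -> : dom c' :\: dom d = (dom c' :\: dom c) :\ v.
    apply/setP => u; rewrite dE in_setD !in_setD1 in_setU1 in_setD.
    case: (eqVneq u v) => [->|uv]; rewrite ?(eq_sym v) ?wv ?andbF //=.
    case: (eqVneq u w) => [->|uw] //=; by rewrite (negbTE wc') !andbF.
  by have := cardsD1 v (dom c' :\: dom c); rewrite -nE in_setD vc vc' add1n => -[].
by exists f' => // u uS; rewrite ff1 ?(subsetP Sc) // f1f'.
Qed.

(** The quantifier over constraints is universal so that operations preserve the condition one
    constraint at a time; by [transfer], a single constraint suffices to verify it. *)
Definition allowed (S : {set V}) (f : V -> B) : Prop :=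
  forall c, constraints I c -> S \subset dom c ->
  exists2 f', {in S, f =1 f'} & satisfies f' c.

Lemma allowed_satisfies c f (S : {set V}) :
  constraints I c -> S \subset dom c -> satisfies f c -> allowed S f.
Proof. by move=> Ic Sc fc c' Ic' Sc'; exact: transfer Sc Sc' fc. Qed.

Lemma allowed_local (S : {set V}) f f' :
  {in S, f =1 f'} -> allowed S f -> allowed S f'.
Proof.
move=> ff' fS c Ic Sc; have [f1 ff1 f1c] := fS c Ic Sc.
by exists f1 => // v vS; rewrite -ff' ?ff1.
Qed.

Lemma allowed_closed (S : {set V}) : op_closed Clo (allowed S).
Proof.
move=> g [t gt] F FS c Ic Sc.
have /choice[f fP] i : exists f, {in S, F i =1 f} /\ satisfies f c.
  by have [f ? ?] := FS i c Ic Sc; exists f.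
exists (fun v => g (f^~ v)).
  by move=> v vS /=; congr g; apply/funext => i; exact: (fP i).1.
rewrite /satisfies (_ : (fun i => _) =
    (fun j => eval (fun i => f i (scope c j)) t)); last first.
  by apply/funext => j; rewrite gt.
apply: (subuniverse_eval (F := fun i j => f i (scope c j))); first exact: overI.
by move=> i; exact: (fP i).2.
Qed.

Lemma near_unanimity_sensitive : sensitive I.
Proof.
move=> c Ic t ct.
have [f fE] : exists f : V -> B, forall i, f (scope c i) = t i.
  case: kkI => [[arity _ _] _]; have [_ inj] := arity c Ic.
  have c0 : 0 < con_arity c by rewrite (arity c Ic).1 ltnW.
  exists (fun v => if [pick i | scope c i == v] is Some i then t i else t (Ordinal c0)) => i.
  by case: pickP => [j /eqP/inj->//|/(_ i)]; rewrite eqxx.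
have fc : satisfies f c by rewrite /satisfies (_ : (fun i => _) = t) //; apply/funext.
suff [f' ff' f'sol] : exists2 f', {in dom c, f =1 f'} &
    forall d, constraints I d -> satisfies f' d.
  by exists f' => // i; rewrite -fE ff' ?mem_scope.
(* With at most [k] variables there is no set of size [k.+1], but every scope is all of [V]. *)
case: (leqP #|V| k) => Vk.
  have full d : constraints I d -> dom d = setT.
    by move=> /card_dom dk; apply/eqP; rewrite eqEcard subsetT cardsT dk.
  exists f => // d Id; have [||f' ff'] := @transfer c d f setT Ic Id _ _ fc.
  - by rewrite full.
  - by rewrite full.
  by apply: satisfies_local => v _; rewrite ff'.
have cover (S W : {set V}) : S \subset W -> #|S| <= k -> k <= #|W| ->
    exists2 d, constraints I d & S \subset dom d /\ dom d \subset W.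
  move=> SW Sk kW; have [|K [SK KW KE]] := superset_card (n := k) SW.
    by rewrite Sk.
  by have [d Id dE] := constraint_on KE; exists d; rewrite ?dE.
have allowed_sub (S S' : {set V}) f1 :
    S' \subset S -> #|S| <= k -> allowed S f1 -> allowed S' f1.
  move=> S'S Sk f1S; have [|d Id [Sd _]] := cover S setT (subsetT _) Sk.
    by rewrite cardsT ltnW.
  have [f2 f12 f2d] := f1S d Id Sd.
  apply: (@allowed_local _ f2); first by move=> v /(subsetP S'S) vS; rewrite f12.
  by apply: allowed_satisfies Id _ f2d; exact: subset_trans Sd.
have small (W : {set V}) : #|W| <= k.+1 -> extendable k allowed W.
  move=> Wk S f1 SW Sk f1S.
  have [|W' [WW' _ W'k]] := superset_card (n := k.+1) (subsetT W).
    by rewrite Wk cardsT.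
  have kW' : k <= #|W'| by rewrite W'k.
  have [d Id [Sd dW']] := cover S W' (subset_trans SW WW') Sk kW'.
  have [f2 f12 f2d] := f1S d Id Sd.
  have [f3 f23 f3W] := extend_one W'k Id dW' f2d.
  exists f3 => [v vS|S' S'W S'k]; first by rewrite f12 // f23 // (subsetP Sd).
  have [d' Id' [S'd' d'W']] := cover S' W' (subset_trans S'W WW') S'k kW'.
  exact: allowed_satisfies Id' S'd' (f3W _ Id' d'W').
have ck : #|dom c| <= k by rewrite card_dom.
have [f' ff' solf'] := all_extendable k_gt1 term_operation_idem
  term_operation_nu allowed_local allowed_sub (fun S _ => @allowed_closed S)
  small (subsetT (dom c)) ck (allowed_satisfies Ic (subxx _) fc).
exists f' => // d Id; have dk : #|dom d| <= k by rewrite card_dom.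
have [f1 f'1] := solf' (dom d) (subsetT _) dk d Id (subxx _).
by apply: satisfies_local => v vd; rewrite f'1.
Qed.

End NearUnanimitySensitive.

(** * Local near unanimity from a sensitive instance *)

Fixpoint power_term (A : algebra) (n : nat) (X : Type) (t : term A X) :
    term (power A n) X :=
  match t with
  | Var x => @Var (power A n) X x
  | App f ts => @App (power A n) X f (fun j => power_term n (ts j))
  end.

Lemma eval_power_term (A : algebra) (n : nat) (X : Type) (t : term A X)
    (v : X -> 'I_n -> A) :
  eval (v : X -> power A n) (power_term n t) = (fun i => eval (v^~ i) t).
Proof.
elim: t => [//|f ts IH] /=; apply/funext => i; congr (op f _).
by apply/funext => j; rewrite IH.
Qed.

Lemma local_near_unanimity_power (A : algebra) (m n : nat) :
  local_near_unanimity m A -> local_near_unanimity m (power A n).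
Proof.
move=> nuA S finS.
pose S' : set A := [set p.1 p.2 | p in S `*` [set: 'I_n]]%classic.
have finS' : finite_set S'.
  by apply/finite_image/finite_setX => //; exact: finite_finset.
have [g [t gt] gS'] := nuA S' finS'.
exists (fun x => eval x (power_term n t)) => [|a b i Sa Sb].
  by exists (power_term n t).
rewrite eval_power_term; apply/funext => l.
rewrite -gt -[RHS](gS' (a l) (b l) i); first last.
- by exists (b, l).
- by exists (a, l).
by congr g; apply/funext => j; case: eqP.
Qed.

Lemma idempotent_power (A : algebra) (n : nat) :
  idempotent_algebra A -> idempotent_algebra (power A n).
Proof. by move=> idA f a; apply/funext => i /=; exact: idA. Qed.

Fixpoint subst_term (A : algebra) (X Y : Type) (s : X -> term A Y)
    (t : term A X) : term A Y :=
  match t with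
  | Var x => s x
  | App f ts => App (fun j => subst_term s (ts j))
  end.

Lemma eval_subst_term (A : algebra) (X Y : Type) (s : X -> term A Y) t v :
  eval v (subst_term s t) = eval (fun x => eval v (s x)) t.
Proof. by elim: t => [//|f ts IH] /=; congr (op f _); apply/funext. Qed.

(** * From one condition per place to finitely many *)

Section LocalConditions.

Variables (A : algebra) (m : nat).
Hypothesis idA : idempotent_algebra A.
Hypothesis one_condition : forall a b : 'I_m -> A,
  exists t : term A 'I_m,
    forall i, eval (fun j => if j == i then b i else a i) t = a i.

(** If the place [i] has conditions [q :: r], a term [f] for all conditions but [q] is put into the
    place [i] of a term [g], whose only condition at [i] is [(q.1, w)] with [w] the value of [f]
    under [q]. Under a condition from [r], [g] receives a constant tuple and idempotence applies;
    under conditions at other places its input is unchanged. *)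
Lemma finitely_many_conditions n
    (Q : 'I_m -> seq ({classic A} * {classic A})) (c : A) :
  \sum_i size (Q i) <= n ->
  exists t : term A 'I_m, forall i p, p \in Q i ->
    eval (fun j => if j == i then (p.2 : A) else p.1) t = p.1.
Proof.
elim: n Q => [|n IH] Q Qn.
  have [t tP] := one_condition (fun=> c) (fun=> c); exists t => i p.
  by move: Qn; rewrite leqn0 sum_nat_eq0 => /forallP/(_ i)/= /nilP->.
have [/existsP[i i2]|small] := boolP [exists i, 1 < size (Q i)]; last first.
  pose h i : {classic A} * {classic A} := head (c, c) (Q i).
  have [t tP] := one_condition (fun i => (h i).1) (fun i => (h i).2).
  exists t => i p; move/existsPn/(_ i): small; rewrite -leqNgt.
  have := tP i; rewrite /h; case: (Q i) => [//|q [|//]] /= tq _.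
  by rewrite inE => /eqP->.
case Qi: (Q i) i2 => [//|q r] /=; rewrite ltnS => r0.
pose set_at s := fun j => if j == i then s else Q j.
have size_set_at s : size s < size (Q i) ->
    \sum_j size (set_at s j) <= n.
  move=> sQ; rewrite -ltnS; apply: leq_trans Qn.
  rewrite (bigD1 i) //= [ltnRHS](bigD1 i) //= /set_at eqxx -addSn leq_add //.
  by apply: leq_sum => j /negbTE->.
have [|f fP] := IH (set_at r); first by apply: size_set_at; rewrite Qi.
pose w : A := eval (fun j => if j == i then (q.2 : A) else q.1) f.
have [|g gP] := IH (set_at [:: (q.1, w)]).
  by apply: size_set_at; rewrite Qi.
exists (subst_term (fun j => if j == i then f else Var A j) g) => l p pQ.
rewrite eval_subst_term.
pose v j : A := if j == l then p.2 else p.1.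
rewrite (_ : (fun j => _) = (fun j => if j == i then eval v f else v j));
  last by apply/funext => j; case: (j == i).
case: (eqVneq l i) pQ => [li|li] pQ; last first.
  have vf : eval v f = p.1 by apply: fP; rewrite /set_at (negbTE li).
  rewrite -[RHS](gP l p); last by rewrite /set_at (negbTE li).
  congr eval; apply/funext => j; rewrite vf /v.
  by case: (eqVneq j i) => // ->; rewrite eq_sym (negbTE li).
move: pQ; rewrite li Qi inE => /predU1P[pq|pr].
  rewrite (_ : eval v f = w); last by rewrite /w /v li pq.
  rewrite pq -[RHS](gP i (q.1, w)); last by rewrite /set_at eqxx inE.
  by congr eval; apply/funext => j; rewrite /v li pq; case: (j == i).
have vf : eval v f = p.1.
  by rewrite /v li; apply: fP; rewrite /set_at eqxx.
rewrite vf (_ : (fun j => _) = (fun=> (p.1 : A))) ?eval_term_idempotent //.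
by apply/funext => j; rewrite /v li; case: (j == i).
Qed.

Lemma local_conditions : 0 < m -> local_near_unanimity m A.
Proof.
move=> m0 S finS; have [[c Sc]|noS] := pselect (exists c, S c); last first.
  exists (fun x => x (Ordinal m0)); first by exists (Var A (Ordinal m0)).
  by move=> a b i Sa; case: noS; exists a.
have /finite_seqP[s sE] : finite_set (S : set {classic A}) := finS.
pose Q (i : 'I_m) := [seq (a, b) | a <- s, b <- s].
have [t tP] := finitely_many_conditions c (leqnn (\sum_i size (Q i))).
have Ss a : S a -> (a : {classic A}) \in s by rewrite sE.
exists (fun x => eval x t) => [|a b i /Ss sa /Ss sb]; first by exists t.
exact: (tP i (a, b) (allpairs_f _ sa sb)).
Qed.

End LocalConditions.

Lemma cardsD2 (T : finType) (W : {set T}) (u v : T) :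
  u \in W -> v \in W -> u != v -> #|W| = #|W :\ u :\ v|.+2.
Proof.
move=> uW vW uv; rewrite (cardsD1 u W) uW (cardsD1 v (W :\ u)).
by rewrite !inE eq_sym uv vW.
Qed.

(** * An instance that tests whether [a] is generated *)

Section Obstruction.

Variables (A : algebra) (k : nat).
Hypothesis k_gt1 : 1 < k.
Variables a b : 'I_k.+2 -> A.

(* The variables of the instance stand for pairs of coordinates of [k+2]-tuples:
   0, 1, 2, 3 for (0,2), (1,3), (0,1), (2,3), and [v >= 4] for (v,v). Only the
   [k]-sets that miss {0,1} or {2,3} determine all the coordinates; membership
   in [generated] itself is imposed on the former only. *)
Definition coord_nat (v : nat) (e : bool) : nat :=
  match v with
  | 0 => if e then 2 else 0
  | 1 => if e then 3 else 1
  | 2 => if e then 1 else 0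
  | 3 => if e then 3 else 2
  | _ => v
  end.

Definition coord (v : 'I_k.+2) (e : 'I_2) : 'I_k.+2 :=
  inord (coord_nat v (e != ord0)).

Lemma coordE v e : coord v e = coord_nat v (e != ord0) :> nat.
Proof.
rewrite inordK //; have := ltn_ord v.
by case: (v : nat) => [|[|[|[|n]]]] //=; case: ifP => _; lia.
Qed.

(** The [j]-th generator has [b j] at coordinate [j] and agrees with [a] elsewhere. *)
Definition generated (x : 'I_k.+2 -> A) : Prop :=
  exists t : term A 'I_k.+2,
    forall l, x l = eval (fun j => if j == l then b l else a l) t.

Definition agrees (D : pred 'I_k.+2) (n : nat) (sc : 'I_n -> 'I_k.+2)
    (t : 'I_n -> 'I_2 -> A) : Prop :=
  exists2 x, generated x &
    forall i e, D (coord (sc i) e) -> t i e = x (coord (sc i) e).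

(** [predC1 l] drops one coordinate, so that [a] passes this test by way of the [l]-th generator.
    For a scope of [k] distinct variables, the premise on [sc] says that exactly 0 and 1 are
    missing. *)
Definition permitted (n : nat) (sc : 'I_n -> 'I_k.+2) (t : 'I_n -> 'I_2 -> A) :
    Prop :=
  (forall l, agrees (predC1 l) sc t) /\
  ((forall i, 1 < sc i) -> agrees predT sc t).

Definition obstruction : instance (power A 2) :=
  @Instance (power A 2) 'I_k.+2 (fun c =>
    [/\ con_arity c = k, injective (scope c)
      & forall t, rel_of c t <-> permitted (scope c) t]).

Lemma generated_op (f : symbol A) (x : 'I_(op_arity f) -> 'I_k.+2 -> A) :
  (forall j, generated (x j)) -> generated (fun l => op f (x^~ l)).
Proof.
move=> /choice[t tx]; exists (App t) => l /=; congr (op f _).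
by apply/funext => j; exact: tx.
Qed.

Lemma agrees_op D n (sc : 'I_n -> 'I_k.+2) (f : symbol A)
    (t : 'I_(op_arity f) -> 'I_n -> 'I_2 -> A) :
  (forall j, agrees D sc (t j)) -> agrees D sc (fun i e => op f (fun j => t j i e)).
Proof.
move=> agr; have /choice[x xP] j : exists x, generated x /\
    forall i e, D (coord (sc i) e) -> t j i e = x (coord (sc i) e).
  by have [x ? ?] := agr j; exists x.
exists (fun l => op f (x^~ l)); first by apply: generated_op => j; exact: (xP j).1.
by move=> i e De; congr (op f _); apply/funext => j; exact: (xP j).2.
Qed.

Lemma obstruction_over : instance_over obstruction.
Proof.
move=> c [_ _ relE] f t tP; apply/relE; split.
  by move=> l; apply: agrees_op => j; have /relE[+ _] := tP j.
by move=> sc1; apply: agrees_op => j; have /relE[_] := tP j; exact.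
Qed.

Lemma agrees_reindex D n n' (sc : 'I_n -> 'I_k.+2) t (s : 'I_n' -> 'I_n) :
  agrees D sc t -> agrees D (sc \o s) (t \o s).
Proof. by move=> [x Gx xP]; exists x => // i e; exact: xP. Qed.

Lemma permitted_reindex n n' (sc : 'I_n -> 'I_k.+2) t (s : 'I_n' -> 'I_n) :
  bijective s -> permitted sc t -> permitted (sc \o s) (t \o s).
Proof.
move=> [s' s'K sK] [weak strong]; split=> [l|gt1]; apply: agrees_reindex => //.
by apply: strong => i; rewrite -(sK i); exact: gt1.
Qed.

Lemma obstruction_uniform : uniform k obstruction.
Proof.
split; first by move=> c [].
- move=> W cW.
  pose sc (i : 'I_k) : 'I_k.+2 := enum_val (cast_ord (esym cW) i).
  exists (@Constraint _ (power A 2) k sc (permitted sc)).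
    by split=> // i j /enum_val_inj/cast_ord_inj.
  move=> v; apply/codomP/idP => [[i ->]|vW]; first exact: enum_valP.
  exists (cast_ord cW (enum_rank_in vW v)).
  by rewrite /= /sc cast_ordK enum_rankK_in.
move=> c c' [ck inj rE] [ck' inj' rE'] cc'.
have sP i : scope c' i \in codom (scope c) by rewrite cc' codom_f.
pose s i := iinv (sP i).
have sE i : scope c (s i) = scope c' i by exact: f_iinv.
have s_inj : injective s by move=> i j /(congr1 (scope c)); rewrite !sE => /inj'.
have s_bij : bijective s by apply: inj_card_bij => //; rewrite !card_ord ck ck'.
have scE : scope c' = scope c \o s by apply/funext => i; rewrite /= sE.
exists s; split=> // t; rewrite rE rE' scE; split; first exact: permitted_reindex.
have [s' s'K sK] := s_bij.
have s'_bij : bijective s' by exists s.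
move=> /(permitted_reindex s'_bij).
rewrite (_ : (scope c \o s) \o s' = scope c); last first.
  by apply/funext => i; rewrite /= sK.
by rewrite (_ : _ \o s' = t) //; apply/funext => i; rewrite /= sK.
Qed.

(** If [t] is the projection of a generated tuple, this tuple gives a solution. Otherwise the scope
    of [t] covers all coordinates and contains 0 or 1; counting shows that it contains both. So [W]
    contains 0 and 1, no [k]-set within [W] misses both, and only proper projections have to be
    respected. *)
Lemma obstruction_restriction (W : {set var obstruction}) :
  #|W| = k.+1 -> sensitive (restriction W).
Proof.
move=> cW c [/= ck sc_inj relE] t /relE[weak strong].
pose sc i : 'I_k.+2 := val (scope c i).
rewrite -[fun i => val _]/sc in weak strong sc_inj.
have weak_sol (d : 'I_k.+2 -> A) (D : constraint {v | v \in W} (power A 2)) :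
    constraints (restriction W) D ->
    (forall l, exists2 x, generated x & forall l', l' != l -> d l' = x l') ->
    ((forall i, 1 < val (scope D i)) -> exists2 x, generated x & d = x) ->
    rel_of D (fun i => (fun e => d (coord (val (scope D i)) e))).
  move=> [_ _ relD] dweak dstrong; apply/relD; split=> [l|/dstrong].
    by have [x Gx dx] := dweak l; exists x => // i e; exact: dx.
  by move=> [x Gx dx]; exists x => // i e _; rewrite dx.
have [[x [Gx xt]]|noglobal] := pselect (exists x, generated x /\
    forall i e, t i e = x (coord (sc i) e)).
  exists (fun v e => x (coord (val v) e)).
    by move=> D ID; apply: weak_sol => // [l|_]; exists x.
  by move=> i; apply/funext => e; rewrite xt.
have cov l : exists ie : 'I_(con_arity c) * 'I_2, coord (sc ie.1) ie.2 = l.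
  apply: contrapT => /forallNP ncov; apply: noglobal.
  have [x Gx xt] := weak l; exists x; split=> // i e; apply: xt.
  by apply/eqP; exact: (ncov (i, e)).
have lowi : exists i, sc i <= 1.
  apply: contrapT => /forallNP high; apply: noglobal.
  have [|x Gx xt] := strong; last by exists x; split=> // i e; exact: xt.
  by move=> i; rewrite ltnNge; apply/negP; exact: high.
have [iv ivE] := choice cov.
pose d l := t (iv l).1 (iv l).2.
have td i e : t i e = d (coord (sc i) e).
  set l := coord (sc i) e.
  have [l' ll'] : exists l', l != l'.
    case: (eqVneq l ord0) => [->|]; last by exists ord0.
    by exists ord_max.
  have [x Gx xt] := weak l'.
  by rewrite /d !xt /= ?ivE.
pose C : {set 'I_k.+2} := ~: [set v in codom sc].
have cC : #|C| = 2.
  have codom_k : #|[set v in codom sc]| = k by rewrite cardsE card_codom // card_ord.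
  by apply/eqP; rewrite -(eqn_add2l k) -{1}codom_k cardsC card_ord addn2.
have Cnat n : ~ forall v, v \in C -> v = n :> nat.
  move=> Cn; suff : #|C| <= 1 by rewrite cC.
  by apply/card_le1_eqP => u v uC vC; apply/val_inj; rewrite /= !Cn.
pose hit n := exists i, sc i = n :> nat.
have covn n : n < k.+2 -> exists i e, coord_nat (sc i) e = n.
  move=> nk; have := ivE (Ordinal nk) => /(congr1 val); rewrite /= coordE => ne.
  by exists (iv (Ordinal nk)).1, ((iv (Ordinal nk)).2 != ord0).
have hit0 : hit 0 \/ hit 2.
  have [//|i [e]] := covn 0.
  by case E: (val (sc i)) => [|[|[|[|n]]]]; case: e => // _; [left|right]; exists i.
have hit1 : hit 1 \/ hit 2.
  have [//|i [e]] := covn 1.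
  by case E: (val (sc i)) => [|[|[|[|n]]]]; case: e => // _; [left|right]; exists i.
have hit2 : hit 0 \/ hit 3.
  have [|i [e]] := covn 2; first by lia.
  by case E: (val (sc i)) => [|[|[|[|n]]]]; case: e => // _; [left|right]; exists i.
have hit3 : hit 1 \/ hit 3.
  have [|i [e]] := covn 3; first by lia.
  by case E: (val (sc i)) => [|[|[|[|n]]]]; case: e => // _; [left|right]; exists i.
have hit01 : hit 0 \/ hit 1.
  have [i] := lowi.
  by case E: (val (sc i)) => [|[|n]] // _; [left|right]; exists i.
have missC v : v \in C -> v < 4 /\ ~ hit v.
  rewrite !inE => vC; have nhit : ~ hit v.
    by move=> [i iv']; move/negP: vC; apply; apply/codomP; exists i; exact: val_inj.
  split=> //; rewrite ltnNge; apply/negP => v4; apply: nhit.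
  have [i [e ie]] := covn v (ltn_ord v); exists i; move: ie.
  by case E: (val (sc i)) => [|[|[|[|n]]]]; case: e => //= vE; move: v4; rewrite -?vE.
(* If 0 were missed, the coordinates 0 and 2 would force the variables 2 and 3 into the scope,
   besides 1, and [C] would have at most one element; likewise for 1. *)
have low_hit n : n <= 1 -> hit n.
  move=> n1; apply: contrapT => nhit; apply: (Cnat n) => v /missC[v4 nv].
  have hit_all l : l < 4 -> l <> n -> hit l.
    by case: n n1 nhit => [|[|//]] _ nhit; case: l => [|[|[|[|//]]]] // _ _;
      tauto.
  by apply: contrapT => vn; apply: nv; exact: hit_all.
exists (fun v e => d (coord (val v) e)); last first.
  by move=> i; apply/funext => e; rewrite td.
move=> D ID; apply: weak_sol => // [l|high].
  have [x Gx xt] := weak l; exists x => // l' l'l.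
  by rewrite /d xt /= ?ivE.
case: ID => /= Dk D_inj _; exfalso.
have lowW n (nk : n < k.+2) : n <= 1 -> Ordinal nk \in W.
  move=> /low_hit[i iE]; rewrite (_ : Ordinal nk = sc i); first exact: valP.
  exact/val_inj.
have cW2 := cardsD2 (lowW 0 isT isT) (lowW 1 isT isT) isT.
rewrite {}cW in cW2; case: cW2 => kE.
suff : k <= #|W :\ Ordinal (isT : 0 < k.+2) :\ Ordinal (isT : 1 < k.+2)|.
  by rewrite {1}kE ltnn.
rewrite -{1}Dk -(card_ord (con_arity D)) -(card_codom D_inj).
apply: subset_leq_card; apply/subsetP => _ /codomP[i ->].
rewrite !in_setD1; apply/and3P; split; last exact: valP.
  by apply/eqP => iE; move: (high i); rewrite /= iE.
by apply/eqP => iE; move: (high i); rewrite /= iE.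
Qed.

(** The tuple [a] is permitted on the variables other than 2 and 3, and a solution through it agrees
    with a generated tuple on those other than 0 and 1. Both sets of variables cover all
    coordinates, and a solution has only one value per coordinate, so [a] is that generated
    tuple. *)
Lemma obstruction_generates : sensitive obstruction -> generated a.
Proof.
move=> sens; have [[_ ex _] _] := (obstruction_uniform, tt).
have sub (S : {set 'I_k.+2}) : #|S| <= k ->
    exists2 c, constraints obstruction c & S \subset codom (scope c).
  move=> Sk; have [|K [SK _ Kk]] := superset_card (n := k) (subsetT S).
    by rewrite Sk cardsT card_ord; lia.
  have [c Ic cK] := ex K Kk; exists c => //.
  by apply/subsetP => v /(subsetP SK); rewrite cK.
have pairC (u v : 'I_k.+2) : u != v -> exists2 c, constraints obstruction c &
    codom (scope c) =i ~: [set u; v].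
  move=> uv; apply: ex; have := cardsC [set u; v].
  by rewrite cards2 uv card_ord add2n => -[].
have o2P : 2 < k.+2 by lia.
have o3P : 3 < k.+2 by lia.
pose o0 : 'I_k.+2 := ord0; pose o1 : 'I_k.+2 := Ordinal (isT : 1 < k.+2).
pose o2 : 'I_k.+2 := Ordinal o2P; pose o3 : 'I_k.+2 := Ordinal o3P.
have [c Ic cE] := pairC o2 o3 isT.
have [f fsol fc] : exists2 f : 'I_k.+2 -> 'I_2 -> A, solution (I := obstruction) f &
    forall i, f (scope c i) = (fun e => a (coord (scope c i) e)).
  apply: sens => //; case: (Ic) => _ _ relE; apply/relE; split=> [l|high].
    exists (fun l' => if l' == l then b l' else a l').
      by exists (Var A l) => l' /=; rewrite eq_sym.
    by move=> i e /= /negbTE->.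
  have /codomP[i iE] : o0 \in codom (scope c) by rewrite cE !inE.
  by have := high i; rewrite -iE.
have fE (v : 'I_k.+2) e : v != o2 -> v != o3 -> f v e = a (coord v e).
  move=> v2 v3; have /codomP[i ->] : v \in codom (scope c).
    by rewrite cE !inE negb_or v2.
  by rewrite fc.
(* As [k > 1], some constraint contains both [u] and [v]; the projection that drops a coordinate
   other than the shared one gives the equality. *)
have feq u v e e' : coord u e = coord v e' -> f u e = f v e'.
  move=> uv; have [|c' Ic' /subsetP c'uv] := sub [set u; v].
    by rewrite cards2; case: eqP => _ //; exact: ltnW.
  have [l ll'] : exists l, coord u e != l.
    case: (eqVneq (coord u e) ord0) => [->|]; last by exists ord0.
    by exists ord_max.
  have /codomP[i uE] := c'uv u (set21 _ _).
  have /codomP[j vE] := c'uv v (set22 _ _).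
  case: (Ic') => _ _ relE; have /relE[/(_ l)[x _ xf] _] := fsol c' Ic'.
  by rewrite uE vE !xf /= -?uE -?vE -?uv.
have [c' Ic' c'E] := pairC o0 o1 isT.
have [x Gx xf] : agrees predT (scope c') (fun i => f (scope c' i)).
  case: (Ic') => _ _ relE; have /relE[_] := fsol c' Ic'; apply=> i.
  have : scope c' i \in ~: [set o0; o1] by rewrite -c'E codom_f.
  by rewrite !inE -!val_eqE /=; case: (val _) => [|[|n]].
suff -> : a = x by [].
apply/funext => l.
have coordP (v l' : 'I_k.+2) e : coord_nat v (e != ord0) = l' -> coord v e = l'.
  by move=> vl; apply/val_inj; rewrite /= coordE.
have [v [e [v2 v3 vl]]] : exists v e, [/\ v != o2, v != o3 & coord v e = l].
  case: (l) => [[|[|[|[|n]]]] nk].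
  - by exists o0, ord0; split=> //; exact: coordP.
  - by exists o1, ord0; split=> //; exact: coordP.
  - by exists o0, ord_max; split=> //; exact: coordP.
  - by exists o1, ord_max; split=> //; exact: coordP.
  by exists (Ordinal nk), ord0; split=> //; exact: coordP.
have [u [e' [u0 u1 ul]]] : exists v e, [/\ v != o0, v != o1 & coord v e = l].
  case: (l) => [[|[|[|[|n]]]] nk].
  - by exists o2, ord0; split=> //; exact: coordP.
  - by exists o2, ord_max; split=> //; exact: coordP.
  - by exists o3, ord0; split=> //; exact: coordP.
  - by exists o3, ord_max; split=> //; exact: coordP.
  by exists (Ordinal nk), ord0; split=> //; exact: coordP.
have /codomP[i uE] : u \in codom (scope c') by rewrite c'E !inE negb_or u0.
by rewrite -{1}vl -fE // (feq v u e e') ?vl // uE xf // -uE ul.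
Qed.

End Obstruction.

Theorem theorem21 (A : algebra) (k : nat)
    (hA : idempotent_algebra A) (hk : 1 < k) :
  [<-> local_near_unanimity k.+2 A;
       local_near_unanimity k.+2 (power A 2);
       forall I : instance (power A 2),
         instance_over I -> kk1_instance k I -> sensitive I;
       forall I : instance (power A 2),
         instance_over I -> kk1_instance k I -> #|var I| = k.+2 ->
         sensitive I].
Proof.
tfae.
- exact: local_near_unanimity_power.
- move=> nuA2 I; apply: near_unanimity_sensitive => //.
  exact: idempotent_power.
- by move=> sens I overI kkI _; exact: sens.
(* For all [a] and [b], sensitivity of the [obstruction] yields a term that meets one condition per
   place. *)
move=> sens; apply: local_conditions => // a b.
have [|t tP] := @obstruction_generates A k hk a b.
  apply: sens; first exact: obstruction_over.
    by split; [exact: obstruction_uniform|exact: obstruction_restriction].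
  by rewrite card_ord.
by exists t => i; rewrite -tP.
Qed.
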